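(* Let $c>1$ be a real number which is not an integer and let $m\ge 2$ be an integer. Let $G$ be a complex valued function defined on $\{0,1,\ldots,m-1\}$. Then for every multiplicative function $f:\mathbb N\to\mathbb C$ with $|f(n)|\le 1$ for all $n$ and \[\sum_{n<N} f(n)=o(N)\qquad (N\to\infty),\] we have \[\sum_{n<N} f(n)\,G\bigl(\lfloor n^c\rfloor \bmod m\bigr)=o(N)\qquad (N\to\infty).\] *)

(* Defs.v *)
From mathcomp Require Import all_boot all_algebra complex.
From mathcomp Require Import all_classical all_reals all_analysis.
Import GRing.Theory Num.Theory.
Set Implicit Arguments.
Unset Strict Implicit.
Local Open Scope ring_scope.

Definition mult_arith (R : realType) (f : nat -> R[i]) : Prop :=
  f 1%N = 1 /\
  forall a b : nat, (0 < a)%N -> (0 < b)%N -> coprime a b -> f (a * b)%N = f a * f b.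

Definition floor_pow_mod (R : realType) (c : R) (m n : nat) : nat :=
  absz (Num.floor ((n%:R : R) `^ c) %% (m%:Z))%Z.

(* Evaluate G : {0,..,m-1} -> C at k (k < m always holds below when m > 0). *)
Definition evalG (R : realType) (m : nat) (G : 'I_m -> R[i]) (k : nat) : R[i] :=
  if (insub k : option 'I_m) is Some i then G i else 0.

Definition little_o_N (R : realType) (a : nat -> R[i]) : Prop :=
  forall eps : R, 0 < eps -> exists N0 : nat, forall N : nat, (N0 <= N)%N ->
    `|a N| <= ((eps * N%:R)%:C)%C.

(* Main.v *)
Require Import Defs.
From mathcomp Require Import all_boot all_order all_algebra complex.
From mathcomp Require Import all_classical all_reals all_analysis.
From mathcomp Require Import zify ring lra.
Import Order.TTheory GRing.Theory Num.Theory numFieldNormedType.Exports.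
Set Implicit Arguments.
Unset Strict Implicit.
Unset Printing Implicit Defensive.
Local Open Scope ring_scope.

(** As a function of [n ^ c / m] modulo 1, [G (floor (n ^ c) mod m)] is a step
function, and [n ^ c / m] is equidistributed, so up to a small mean error it is
a trigonometric polynomial, built here as a discrete convolution of the step
function with a Fejer kernel.  It thus suffices that [f n * cis (b * n ^ c)] has
mean zero for every real [b]; for [b = 0] this is the hypothesis on [f].  For
[b != 0] Katai's criterion (Turan-Kubilius over a finite set of primes with a
large sum of reciprocals) reduces it to the correlations of [cis (b * (p n) ^ c)]
and [cis (b * (q n) ^ c)] for primes [p != q], which are again phases
[cis (b' * n ^ c)] with [b' = b * (p ^ c - q ^ c) != 0].  These have mean zero:
since [c] is not an integer, the [k]-th difference of [n ^ c] for [k - 1 < c < k]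
decreases to 0 more slowly than [1 / n], so van der Corput differencing leads to
Fejer's theorem on slowly varying sequences. *)

(** * Complex modulus and sequences of mean value zero *)

(** The norm on [R[i]] takes values in [R[i]]; a modulus with values in [R] keeps the estimates in a
    totally ordered field. *)
Definition cmod {R : realType} (z : R[i]) : R := Normc.normc z.
Definition mean_null {R : realType} (z : nat -> R[i]) : Prop :=
  forall e : R, 0 < e -> exists N0 : nat, forall N : nat, (N0 <= N)%N ->
    cmod (\sum_(0 <= n < N) z n) <= e * N%:R.

Section Modulus.
Variable R : realType.
Implicit Types (z w : R[i]) (a : nat -> R[i]).

Lemma normrE_cmod z : `|z| = ((cmod z)%:C)%C.
Proof. by case: z => x y; rewrite normc_def. Qed.

Lemma cmod_ge0 z : 0 <= cmod z.
Proof. by case: z => x y; rewrite /cmod /= sqrtr_ge0. Qed.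

Lemma cmod0 : cmod (0 : R[i]) = 0. Proof. exact: Normc.normc0. Qed.
Lemma cmod1 : cmod (1 : R[i]) = 1. Proof. exact: Normc.normc1. Qed.
Lemma cmodM z w : cmod (z * w) = cmod z * cmod w. Proof. exact: Normc.normcM. Qed.
Lemma cmodD z w : cmod (z + w) <= cmod z + cmod w. Proof. exact: le_normcD. Qed.
Lemma cmodN z : cmod (- z) = cmod z. Proof. exact: normcN. Qed.
Lemma cmodB z w : cmod (z - w) <= cmod z + cmod w.
Proof. by rewrite -(cmodN w) cmodD. Qed.

Lemma cmodJ z : cmod (z^*)%C = cmod z.
Proof. by case: z => x y; rewrite /cmod /= sqrrN. Qed.

Lemma cmod_real (x : R) : cmod (x%:C)%C = `|x|.
Proof. by rewrite /cmod /= expr0n /= addr0 sqrtr_sqr. Qed.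

Lemma cmod_nat n : cmod (n%:R : R[i]) = n%:R.
Proof. by rewrite -(rmorph_nat (real_complex R)) cmod_real normr_nat. Qed.

Lemma cmod_sqr z : ((cmod z ^+ 2)%:C)%C = z * (z^*)%C.
Proof.
by case: z => x y; rewrite /cmod /= sqr_sqrtr ?addr_ge0 ?sqr_ge0//; simpc;
  congr (_ +i* _)%C; ring.
Qed.

Lemma cmod_Re z : `|complex.Re z| <= cmod z.
Proof.
case: z => x y; rewrite /cmod /= -sqrtr_sqr ler_wsqrtr// lerDl sqr_ge0 //.
Qed.

Lemma cmod_sum (I : Type) (r : seq I) (P : pred I) (F : I -> R[i]) :
  cmod (\sum_(i <- r | P i) F i) <= \sum_(i <- r | P i) cmod (F i).
Proof.
elim/big_rec2: _ => [|i y x _ h]; first by rewrite cmod0.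
by rewrite (le_trans (cmodD _ _))// lerD2l.
Qed.

Lemma cmod_sum_nat_le (F : nat -> R[i]) (b : R) M N : (M <= N)%N ->
  (forall n, (M <= n < N)%N -> cmod (F n) <= b) ->
  cmod (\sum_(M <= n < N) F n) <= b * (N - M)%:R.
Proof.
move=> MN h; apply: le_trans (cmod_sum _ _ _) _; rewrite big_nat (le_trans (ler_sum _ h))// -big_nat sumr_const_nat.
by rewrite mulr_natr.
Qed.

End Modulus.

Section MeanNull.
Variable R : realType.
Implicit Types (a b : nat -> R[i]).

Lemma eq_mean_null a b : a =1 b -> mean_null a -> mean_null b.
Proof.
move=> ab ha e e0; have [N0 h] := ha e e0; exists N0 => N NN0.
by rewrite (eq_bigr a) ?h// => i _; rewrite ab.
Qed.

Lemma mean_nullD a b : mean_null a -> mean_null b ->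
  mean_null (fun n => a n + b n).
Proof.
move=> ha hb e e0; have e20 : 0 < e / 2 by lra.
have [N1 h1] := ha _ e20; have [N2 h2] := hb _ e20.
exists (maxn N1 N2) => N; rewrite geq_max => /andP[/h1 {}h1 /h2 {}h2].
by rewrite big_split (le_trans (cmodD _ _))//=; lra.
Qed.

Lemma mean_nullZ (k : R[i]) a : mean_null a -> mean_null (fun n => k * a n).
Proof.
move=> ha e e0; have k0 := cmod_ge0 k; have k1 : 0 < cmod k + 1 by lra.
have [N0 h] := ha (e / (cmod k + 1)) (divr_gt0 e0 k1).
exists N0 => N /h{}h; rewrite -mulr_sumr cmodM.
have := cmod_ge0 (\sum_(0 <= n < N) a n).
have : e / (cmod k + 1) * N%:R * (cmod k + 1) = e * N%:R by field; rewrite gt_eqF.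
by nra.
Qed.

Lemma mean_null0 : mean_null (fun _ => 0 : R[i]).
Proof.
by move=> e e0; exists 0%N => N _; rewrite big1_eq cmod0 mulr_ge0// ltW.
Qed.

Lemma mean_null_sum (I : Type) (r : seq I) (P : pred I) (F : I -> nat -> R[i]) :
  (forall i, P i -> mean_null (F i)) ->
  mean_null (fun n => \sum_(i <- r | P i) F i n).
Proof.
move=> h; elim: r => [|i r ih].
  by apply: eq_mean_null mean_null0 => n; rewrite big_nil.
have [Pi|Pi] := boolP (P i).
  apply: eq_mean_null (mean_nullD (h i Pi) ih) => n.
  by rewrite big_cons Pi.
by apply: eq_mean_null ih => n; rewrite big_cons (negbTE Pi).
Qed.

Lemma mean_null_conj a : mean_null a -> mean_null (fun n => (a n)^*%C).
Proof.
move=> ha e /ha[N0 h]; exists N0 => N /h.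
by rewrite -[X in _ -> X <= _]cmodJ rmorph_sum/=; under [X in _ -> cmod X <= _]eq_bigr do rewrite conjcK.
Qed.

Lemma archimedean_nat (x : R) : exists n : nat, forall N, (n <= N)%N -> x <= N%:R.
Proof.
exists (Num.bound `|x|) => N hN; apply: le_trans (ler_norm x) _.
by apply: le_trans (ltW (archi_boundP (normr_ge0 x))) _; rewrite ler_nat.
Qed.

Lemma archimedean_nat_mul (e x : R) : 0 < e ->
  exists n : nat, forall N, (n <= N)%N -> x <= e * N%:R.
Proof.
move=> e0; have [n h] := archimedean_nat (x / e); exists n => N /h.
by rewrite ler_pdivrMr// mulrC.
Qed.

(** For [M] below the threshold given by [ha] the sum is bounded by a fixed constant, which [e * N]
    eventually exceeds. Uniformity in [M] serves for cut-offs that depend on [N]. *)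
Lemma mean_null_partial a : mean_null a -> forall e : R, 0 < e ->
  exists N0 : nat, forall M N : nat, (N0 <= N)%N -> (M <= N)%N ->
    cmod (\sum_(0 <= n < M) a n) <= e * N%:R.
Proof.
move=> ha e e0; have [N1 h1] := ha e e0.
have [N2 h2] := archimedean_nat_mul (\sum_(0 <= n < N1) cmod (a n)) e0.
exists (maxn N1 N2) => M N; rewrite geq_max => /andP[hN1 /h2{}h2] MN.
have [MN1|/h1 hM] := ltnP M N1; last first.
  by rewrite (le_trans hM)// ler_wpM2l ?ler_nat// ltW.
apply: le_trans h2; apply: le_trans (cmod_sum _ _ _) _.
rewrite [leRHS](big_cat_nat (n := M))//=; last exact: ltnW.
by rewrite lerDl sumr_ge0// => i _; exact: cmod_ge0.
Qed.

Lemma sum_shiftE a h N : \sum_(0 <= n < N) a (n + h)%N =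
    \sum_(0 <= n < N + h) a n - \sum_(0 <= n < h) a n.
Proof.
rewrite [X in X - _](big_cat_nat (n := h))//=; last exact: leq_addl.
by rewrite addrAC subrr add0r -{2}[h]add0n big_addn addnK.
Qed.

Lemma mean_null_shiftr a h : mean_null a -> mean_null (fun n => a (n + h)%N).
Proof.
move=> ha e e0; have e30 : 0 < e / 3 by lra.
have [N1 h1] := mean_null_partial ha e30.
have [N2 h2] := archimedean_nat_mul (2 * (e / 3) * h%:R) e30.
exists (maxn N1 N2) => N; rewrite geq_max => /andP[hN1 /h2{}h2].
rewrite sum_shiftE.
have A1 := h1 (N + h)%N (N + h)%N (leq_trans hN1 (leq_addr _ _)) (leqnn _).
have A2 := h1 h (N + h)%N (leq_trans hN1 (leq_addr _ _)) (leq_addl _ _).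
apply: le_trans (cmodB _ _) _.
by move: A1 A2 h2; rewrite (natrD R N h); lra.
Qed.

Lemma mean_null_unshift1 a : mean_null (fun n => a n.+1) -> mean_null a.
Proof.
move=> ha e e0; have e20 : 0 < e / 2 by lra.
have [N1 h1] := ha _ e20.
have [N2 h2] := archimedean_nat_mul (cmod (a 0%N)) e20.
exists (maxn N1 N2).+1 => -[//|N]; rewrite ltnS geq_max => /andP[/h1{}h1 /h2{}h2].
rewrite big_nat_recl// (le_trans (cmodD _ _))//.
by move: h1 h2; rewrite -[N.+1%:R]natr1; lra.
Qed.

(* AM-GM in the form [x <= l / 2 + x ^+ 2 / (2 * l)] with [l = d * A]
   replaces Cauchy-Schwarz. *)
Lemma mean_square_bound (W : nat -> R) (A d : R) N :
  0 < d -> 2 / d ^+ 2 <= A ->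
  \sum_(0 <= n < N) W n ^+ 2 <= 2 * A * N%:R ->
  \sum_(0 <= n < N) W n <= d * A * N%:R.
Proof.
move=> d0 dA hS; have A0 : 0 < A by rewrite (lt_le_trans _ dA)// divr_gt0// exprn_gt0.
have l0 : 0 < d * A by rewrite mulr_gt0.
have hW n : W n <= d * A / 2 + W n ^+ 2 / (2 * (d * A)).
  rewrite -subr_ge0.
  have -> : d * A / 2 + W n ^+ 2 / (2 * (d * A)) - W n
          = (d * A - W n) ^+ 2 / (2 * (d * A)) by field; rewrite !gt_eqF.
  by rewrite divr_ge0 ?sqr_ge0// mulr_ge0// ltW.
apply: le_trans (ler_sum _ (fun n _ => hW n)) _.
rewrite big_split/= sumr_const_nat subn0 -mulr_suml -mulr_natr.
have : (\sum_(0 <= n < N) W n ^+ 2) / (2 * (d * A)) <= d * A / 2 * N%:R; last by lra.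
rewrite ler_pdivrMr ?mulr_gt0//; apply: le_trans hS _.
have : 2 <= A * d ^+ 2 by rewrite -ler_pdivrMr// exprn_gt0.
have : 0 <= N%:R :> R by [].
move=> N0 h; have -> : d * A / 2 * N%:R * (2 * (d * A)) = (A * d ^+ 2) * (A * N%:R) by field.
by rewrite -mulrA ler_wpM2r// mulr_ge0// ltW.
Qed.

End MeanNull.

(** * Mean values of exponentials *)

Section SquaredSums.
Variable R : realType.

Lemma sum_diagE (I : eqType) (r : seq I) (V : nmodType) (F : I -> I -> V) :
  uniq r -> \sum_(i <- r) \sum_(j <- r) F i j =
    \sum_(i <- r) F i i + \sum_(i <- r) \sum_(j <- r | j != i) F i j.
Proof.
move=> ur; rewrite -big_split; apply: eq_big_seq => i ir.
by rewrite (bigD1_seq i).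
Qed.

Lemma cmod_sum_sqr (I : Type) (r : seq I) (F : I -> R[i]) :
  ((cmod (\sum_(i <- r) F i) ^+ 2)%:C)%C =
  \sum_(i <- r) \sum_(j <- r) F i * (F j)^*%C.
Proof. by rewrite cmod_sqr rmorph_sum big_distrlr. Qed.

End SquaredSums.

(** * Van der Corput's difference theorem *)

Section VanDerCorput.
Variable R : realType.
Variable a : nat -> R[i].
Hypothesis a1 : forall n, cmod (a n) <= 1.
Hypothesis acorr : forall h, (0 < h)%N -> mean_null (fun n => a (n + h)%N * (a n)^*%C).

(** Shifting by the smaller of [h] and [k] reduces this to [acorr], up to conjugation. *)
Lemma mean_null_corr2 h k : h != k ->
  mean_null (fun n => a (n + h)%N * (a (n + k)%N)^*%C).
Proof.
have lt i j : (j < i)%N -> mean_null (fun n => a (n + i)%N * (a (n + j)%N)^*%C).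
  move=> ji; have hij : (0 < i - j)%N by rewrite subn_gt0.
  apply: eq_mean_null (mean_null_shiftr j (acorr hij)) => n.
  by rewrite -addnA subnKC// ltnW.
rewrite neq_ltn => /orP[hk|]; last exact: lt.
apply: eq_mean_null (mean_null_conj (lt _ _ hk)) => n.
by rewrite rmorphM /= conjcK mulrC.
Qed.

(** A shift by [h < H] changes the sum by at most [h] terms at each end, and there are [H]
    shifts. *)
Lemma cmod_window_error H N :
  cmod (H%:R * \sum_(0 <= n < N) a n -
    \sum_(0 <= n < N) \sum_(0 <= h < H) a (n + h)%N) <= 2 * H%:R * H%:R.
Proof.
rewrite exchange_big/=.
have -> : H%:R * \sum_(0 <= n < N) a n = \sum_(0 <= h < H) \sum_(0 <= n < N) a n.
  by rewrite sumr_const_nat subn0 mulr_natl.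
rewrite -sumrB -{3}[H]subn0; apply: cmod_sum_nat_le => // h /andP[_ hH].
rewrite sum_shiftE opprB addrA addrAC.
rewrite [X in _ - X + _](big_cat_nat (n := N)) ?leq_addr//=.
have -> (x y z : R[i]) : x - (x + z) + y = y - z by ring.
apply: le_trans (cmodB _ _) _.
have e1 : cmod (\sum_(0 <= i < h) a i) <= 1 * (h - 0)%:R by exact: cmod_sum_nat_le.
have e2 : cmod (\sum_(N <= i < N + h) a i) <= 1 * (N + h - N)%:R.
  by apply: cmod_sum_nat_le => //; exact: leq_addr.
have : h%:R <= H%:R :> R by rewrite ler_nat ltnW.
by move: e1 e2; rewrite subn0 addKn; lra.
Qed.

(** Up to a bounded error, [H] times the sum of [a] is the sum of the windows [W n]. In the mean
    square of [W] the diagonal contributes at most [H * N], and the off-diagonal part [O] has mean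
    zero, so it is eventually at most [H * N] too. *)
Lemma van_der_corput : mean_null a.
Proof.
move=> e e0; have d0 : 0 < e / 2 by lra.
(* This window length meets the requirement of [mean_square_bound] with [d = e / 2] and [A = H]. *)
have [H hH] := archimedean_nat (2 / (e / 2) ^+ 2); have {hH}dH := hH H (leqnn H).
have H0 : 0 < H%:R :> R by rewrite (lt_le_trans _ dH)// divr_gt0// exprn_gt0.
pose O n := \sum_(h <- index_iota 0 H) \sum_(k <- index_iota 0 H | k != h)
  a (n + h)%N * (a (n + k)%N)^*%C.
have hO : mean_null O.
  apply: mean_null_sum => h _; apply: mean_null_sum => k kh.
  by apply: mean_null_corr2; rewrite eq_sym.
have [N1 h1] := hO _ H0.
have [N2 h2] := archimedean_nat_mul (2 * H%:R : R) d0.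
exists (maxn N1 N2) => N; rewrite geq_max => /andP[/h1{}h1 /h2{}h2].
pose W n := \sum_(0 <= h < H) a (n + h)%N.
have hW : \sum_(0 <= n < N) cmod (W n) <= e / 2 * H%:R * N%:R.
  apply: mean_square_bound => //.
  have s0 : 0 <= \sum_(0 <= n < N) cmod (W n) ^+ 2.
    by apply: sumr_ge0 => n _; exact: sqr_ge0.
  (* The real sum of squares is the modulus of its image in [R[i]], where the squares expand into
     double sums. *)
  rewrite -(ger0_norm s0) -cmod_real rmorph_sum/=.
  under eq_bigr do rewrite cmod_sum_sqr sum_diagE ?iota_uniq//.
  rewrite big_split/=; apply: le_trans (cmodD _ _) _.
  have : cmod (\sum_(0 <= n < N) \sum_(0 <= h < H) a (n + h)%N * (a (n + h)%N)^*%C)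
      <= H%:R * (N - 0)%:R.
    apply: cmod_sum_nat_le => // n _; rewrite -{2}[H]subn0 -[(H - 0)%:R]mul1r.
    apply: cmod_sum_nat_le => // h _.
    rewrite cmodM cmodJ; have := a1 (n + h)%N; have := cmod_ge0 (a (n + h)%N); nra.
  by rewrite subn0 /O in h1 *; lra.
have hE := cmod_window_error H N.
have hS : cmod (\sum_(0 <= n < N) W n) <= e / 2 * H%:R * N%:R.
  exact: le_trans (cmod_sum _ _ _) hW.
have : H%:R * cmod (\sum_(0 <= n < N) a n) <= H%:R * (e * N%:R).
  rewrite -[X in X * _](@cmod_nat R) -cmodM -[X in cmod X](subrK (\sum_(0 <= n < N) W n)).
  apply: le_trans (cmodD _ _) _; move: hE hS h2.
  set x := cmod _; set y := cmod _; set z : R := N%:R; set t : R := H%:R.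
  by move=> hx hy hz; have : 0 < t by []; nra.
by rewrite ler_pM2l.
Qed.

End VanDerCorput.

(** * The complex exponential on the real line *)

Definition cis {R : realType} (x : R) : R[i] := (cos x +i* sin x)%C.

Section Cis.
Variable R : realType.
Implicit Types x y : R.

Lemma cis0 : cis 0 = 1 :> R[i]. Proof. by rewrite /cis cos0 sin0. Qed.

Lemma cisD x y : cis (x + y) = cis x * cis y.
Proof. by rewrite /cis cosD sinD; simpc; congr (_ +i* _)%C; ring. Qed.

Lemma cisN x : cis (- x) = (cis x)^*%C.
Proof. by rewrite /cis cosN sinN. Qed.

Lemma cisB x y : cis (x - y) = cis x * (cis y)^*%C.
Proof. by rewrite cisD cisN. Qed.

Lemma cmod_cis x : cmod (cis x) = 1.
Proof. by rewrite /cmod /cis /= cos2Dsin2 sqrtr1. Qed.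

Lemma cisMn x n : cis (n%:R * x) = cis x ^+ n.
Proof.
elim: n => [|n ih]; first by rewrite mul0r cis0 expr0.
by rewrite -natr1 mulrDl mul1r cisD ih exprSr.
Qed.

Lemma cis_2pi : cis (2 * pi) = 1 :> R[i].
Proof. by rewrite /cis mulr_natl cos2pi sin2pi. Qed.

Lemma cis_2piM (k : int) : cis (k%:~R * (2 * pi)) = 1 :> R[i].
Proof.
have natM (n : nat) : cis (n%:R * (2 * pi)) = 1 :> R[i].
  by rewrite cisMn cis_2pi expr1n.
case: k => n; first exact: natM.
by rewrite NegzE rmorphN mulNr cisN natM conjc1.
Qed.

Lemma cmod_cisB1 x : cmod (cis x - 1) ^+ 2 = 2 - 2 * cos x.
Proof.
have -> : cis x - 1 = ((cos x - 1) +i* sin x)%C by rewrite /cis; simpc.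
rewrite /cmod /= sqr_sqrtr ?addr_ge0 ?sqr_ge0//.
by have := cos2Dsin2 x; lra.
Qed.

Lemma sin_le_norm x : `|sin x| <= `|x|.
Proof.
wlog x0 : x / 0 <= x.
  move=> h; have [/h//|x0] := leP 0 x.
  by rewrite -normrN -sinN -[leRHS]normrN h// oppr_ge0 ltW.
have c : {within `[0, x], continuous (@sin R)}%classic.
  by apply: continuous_subspaceT => y; exact: continuous_sin.
have [y _] := MVT_segment x0 (fun y _ => is_derive_sin y) c.
rewrite sin0 !subr0 => ->; rewrite normrM ler_piMl//; exact: cos_max.
Qed.

(** Half-angle formula: [1 - cos x] is twice the square of [sin (x / 2)]. *)
Lemma cos_ge x : 1 - x ^+ 2 / 2 <= cos x.
Proof.
have {2}-> : x = (x / 2) *+ 2 by rewrite -mulr_natr; field.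
rewrite cos_mulr2n cos2sin2.
have : sin (x / 2) ^+ 2 <= (x / 2) ^+ 2.
  by rewrite -(real_normK (num_real (sin _))) -(real_normK (num_real (x / 2)))
    ler_pXn2r ?nnegrE ?normr_ge0 ?sin_le_norm.
rewrite -mulr_natr; nra.
Qed.

Lemma subr_cos_le x : 0 <= x -> 1 - cos x <= x.
Proof.
(* The quadratic bound suffices up to 2; beyond, [1 - cos x] is at most 2. *)
move=> x0; have [x2|x2] := leP x 2; first by have := cos_ge x; nra.
by have := cos_geN1 x; lra.
Qed.

(** By the mean value theorem [sin x = x * cos y] with [0 < y < x], and [1 - cos y <= y]. *)
Lemma subr_sin_le x : 0 <= x -> `|sin x - x| <= x ^+ 2.
Proof.
move=> x0.
have c : {within `[0, x], continuous (@sin R)}%classic.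
  by apply: continuous_subspaceT => y; exact: continuous_sin.
have [y hy] := MVT_segment x0 (fun y _ => is_derive_sin y) c.
rewrite sin0 !subr0 => ->; move: hy; rewrite in_itv/= => /andP[y0 yx].
have := subr_cos_le y0; have := cos_le1 y; rewrite ler_norml; nra.
Qed.

Lemma cis_linear x : 0 <= x -> cmod (cis x - 1 - (0 +i* x)%C) <= 2 * x ^+ 2.
Proof.
move=> x0.
have -> : cis x - 1 - (0 +i* x)%C = ((cos x - 1)%:C)%C + ((sin x - x)%:C)%C * (0 +i* 1)%C.
  by rewrite /cis; simpc; congr (_ +i* _)%C; ring.
apply: le_trans (cmodD _ _) _; rewrite cmodM !cmod_real.
have -> : cmod (0 +i* 1)%C = 1 :> R by rewrite /cmod /= expr0n add0r expr1n sqrtr1.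
have := subr_sin_le x0; have : `|cos x - 1| <= x ^+ 2 / 2; last first.
  by have := sqr_ge0 x; lra.
by rewrite ler_norml; have := cos_ge x; have := cos_le1 x; have := sqr_ge0 x; nra.
Qed.

End Cis.

(** * Fejer's theorem on slowly varying sequences *)

Section Fejer.
Variable R : realType.

(** Cesaro means of a null sequence: the terms before [n0] contribute only a constant. *)
Lemma sum_null_le (d : nat -> R) : (forall n, 0 <= d n) ->
  (forall e : R, 0 < e -> exists n0, forall n, (n0 <= n)%N -> d n <= e) ->
  forall e : R, 0 < e -> exists N0, forall N, (N0 <= N)%N ->
    \sum_(0 <= n < N) d n <= e * N%:R.
Proof.
move=> d0 dnull e e0; have e20 : 0 < e / 2 by lra.
have [n0 h0] := dnull _ e20.
have [n1 h1] := archimedean_nat_mul (\sum_(0 <= n < n0) d n) e20.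
exists (maxn n0 n1) => N; rewrite geq_max => /andP[N0 /h1{}h1].
rewrite (big_cat_nat (n := n0))//=.
have : \sum_(n0 <= i < N) d i <= e / 2 * N%:R; last by lra.
rewrite big_nat; apply: le_trans (ler_sum _ (fun i hi => h0 i _)) _.
  by move=> i /andP[].
rewrite -big_nat sumr_const_nat -[leLHS]mulr_natr ler_wpM2l ?ler_nat ?leq_subr//.
exact: ltW.
Qed.

(** Summation by parts with monotone weights: the increments of [y] telescope to at most [y N]. *)
Lemma abel_bound (E : nat -> R[i]) (y : nat -> R) :
  (forall n, cmod (E n) <= 1) -> (forall n, 0 <= y n <= y n.+1) ->
  forall N, cmod (\sum_(0 <= n < N) (E n.+1 - E n) * ((y n)%:C)%C) <= 2 * y N.
Proof.
move=> E1 hy N.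
have y0 n : 0 <= y n by case/andP: (hy n).
(* With the boundary term subtracted, each induction step costs only [y N.+1 - y N]. *)
have h : cmod (\sum_(0 <= n < N) (E n.+1 - E n) * ((y n)%:C)%C - E N * ((y N)%:C)%C) <= y N.
  elim: N => [|N ih].
    rewrite big_geq// sub0r cmodN cmodM cmod_real ger0_norm//.
    by rewrite ler_piMl.
  rewrite big_nat_recr//=; set S := \sum_(0 <= n < N) _ in ih *.
  have -> : S + (E N.+1 - E N) * ((y N)%:C)%C - E N.+1 * ((y N.+1)%:C)%C =
    (S - E N * ((y N)%:C)%C) - E N.+1 * ((y N.+1 - y N)%:C)%C.
    by rewrite rmorphB /=; ring.
  apply: le_trans (cmodB _ _) _; rewrite cmodM cmod_real.
  have hd : 0 <= y N.+1 - y N by rewrite subr_ge0; case/andP: (hy N).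
  rewrite ger0_norm//; have := E1 N.+1; have := cmod_ge0 (E N.+1); nra.
rewrite -[X in cmod X](subrK (E N * ((y N)%:C)%C)).
apply: le_trans (cmodD _ _) _; rewrite cmodM cmod_real ger0_norm//.
by have := E1 N; have := cmod_ge0 (E N); have := y0 N; nra.
Qed.

(** Fejer's conditions on the first difference of a phase: it decreases to 0, but more slowly than
    [1 / n]. *)
Definition slow (d : nat -> R) :=
  [/\ forall n, 0 < d n, forall n, d n.+1 <= d n,
      forall e : R, 0 < e -> exists n0, forall n, (n0 <= n)%N -> d n <= e &
      forall B, exists n0, forall n, (n0 <= n)%N -> B <= n%:R * d n].

Definition fdiff (u : nat -> R) n := u n.+1 - u n.

(** Since [E n.+1 - E n] is close to [i * d n * E n], the term [E n] is [- i * (E n.+1 - E n) / d n]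
    up to [2 * d n]. The errors have mean zero because [d] tends to 0; by Abel summation the main
    sum is at most [2 / d N], which is small against [N] because [N * d N] is unbounded. *)
Lemma fejer_mean_null (u : nat -> R) : slow (fdiff u) ->
  mean_null (fun n => cis (u n)).
Proof.
case=> d0 dD dnull dinf e e0; set d := fdiff u in d0 dD dnull dinf.
have e40 : 0 < e / 4 by lra.
have [N1 h1] := sum_null_le (fun n => ltW (d0 n)) dnull e40.
have [N2 h2] := dinf (4 / e).
exists (maxn N1 N2) => N; rewrite geq_max => /andP[/h1{}h1 /h2{}h2].
pose y n := (d n)^-1; pose E n := cis (u n).
have hE n : cmod (E n) <= 1 by rewrite cmod_cis.
have hy n : 0 <= y n <= y n.+1.
  by rewrite invr_ge0 ltW//= lef_pV2 ?posrE.
have hA := abel_bound hE hy N.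
have step n : cmod (E n - (0 +i* (-1))%C * ((E n.+1 - E n) * ((y n)%:C)%C)) <= 2 * d n.
  have -> : E n - (0 +i* (-1))%C * ((E n.+1 - E n) * ((y n)%:C)%C) =
     (0 +i* 1)%C * E n * ((y n)%:C)%C * (cis (d n) - 1 - (0 +i* d n)%C).
    have -> : E n.+1 = E n * cis (d n) by rewrite -cisD /d /fdiff addrC subrK.
    have -> : (0 +i* d n)%C = (0 +i* 1)%C * ((d n)%:C)%C by simpc.
    have hd : ((y n)%:C)%C * ((d n)%:C)%C = 1 by rewrite -rmorphM mulVf// gt_eqF.
    have hi : (0 +i* 1)%C * (0 +i* 1)%C = -1 :> R[i] by simpc.
    have -> : (0 +i* (-1))%C = - (0 +i* 1)%C :> R[i] by simpc.
    have -> (i x c y' d' : R[i]) : i * x * y' * (c - 1 - i * d') =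
      i * x * y' * (c - 1) - i * i * x * (y' * d') by ring.
    by rewrite hd hi; ring.
  rewrite !cmodM cmod_cis cmod_real.
  have -> : cmod (0 +i* 1)%C = 1 :> R by rewrite /cmod /= expr0n add0r expr1n sqrtr1.
  rewrite !mul1r gtr0_norm ?invr_gt0// ler_pdivrMl//.
  by rewrite (le_trans (cis_linear (ltW (d0 n))))//; nra.
have -> : \sum_(0 <= n < N) E n =
   \sum_(0 <= n < N) (E n - (0 +i* (-1))%C * ((E n.+1 - E n) * ((y n)%:C)%C)) +
   (0 +i* (-1))%C * \sum_(0 <= n < N) ((E n.+1 - E n) * ((y n)%:C)%C).
  by rewrite sumrB mulr_sumr subrK.
apply: le_trans (cmodD _ _) _; rewrite cmodM.
have -> : cmod (0 +i* (-1))%C = 1 :> R by rewrite /cmod /= expr0n add0r sqrrN expr1n sqrtr1.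
rewrite mul1r.
have a1 : cmod (\sum_(0 <= n < N) (E n - (0 +i* (-1))%C * ((E n.+1 - E n) * ((y n)%:C)%C)))
    <= 2 * (e / 4 * N%:R).
  apply: le_trans (cmod_sum _ _ _) _; apply: le_trans (ler_sum _ (fun n _ => step n)) _.
  by rewrite -mulr_sumr ler_pM2l.
have a2 : y N <= e / 4 * N%:R.
  rewrite /y -[leLHS]mul1r ler_pdivrMr//.
  have : e / 4 * (4 / e) = 1 by field; rewrite gt_eqF.
  nra.
by lra.
Qed.

End Fejer.

(** * Iterated differences of phases *)

Section Differencing.
Variable R : realType.
Implicit Types u : nat -> R.

Lemma eq_slow (d d' : nat -> R) : d =1 d' -> slow d -> slow d'.
Proof. by move=> /funext ->. Qed.

Lemma iter_fdiff_shift k h u n :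
  iter k (@fdiff R) (fun n => u (n + h)%N - u n) n =
  iter k (@fdiff R) u (n + h)%N - iter k (@fdiff R) u n.
Proof. by elim: k n => //= k ih n; rewrite /fdiff !ih addSn; ring. Qed.

Lemma fdiff_telescope (v : nat -> R) h n :
  v (n + h)%N - v n = \sum_(0 <= j < h) fdiff v (n + j)%N.
Proof.
elim: h => [|h ih]; first by rewrite big_geq// addn0 subrr.
by rewrite big_nat_recr//= -ih /fdiff addnS; ring.
Qed.

(** By monotonicity the sum lies between its first term [d n] and [h * d n]. By telescoping, an
    [h]-step difference is such a sum of one-step differences. *)
Lemma slow_sum (d : nat -> R) h : (0 < h)%N -> slow d ->
  slow (fun n => \sum_(0 <= j < h) d (n + j)%N).
Proof.
case: h => // h _ [d0 dD dnull dinf].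
have anti n m : (n <= m)%N -> d m <= d n.
  by move=> /subnK <-; elim: (m - n)%N => // k /(le_trans (dD _)).
have first n : d n <= \sum_(0 <= j < h.+1) d (n + j)%N.
  by rewrite big_nat_recl// addn0 lerDl sumr_ge0// => i _; exact: ltW.
split=> [n|n|e e0|B].
- exact: lt_le_trans (first n).
- by apply: ler_sum => j _; rewrite addSn.
- have [n0 h0] := dnull (e / h.+1%:R) (divr_gt0 e0 (ltr0Sn _ _)).
  exists n0 => n /h0 hn.
  apply: (@le_trans _ _ (\sum_(0 <= j < h.+1) (e / h.+1%:R))).
    by apply: ler_sum => j _; apply: le_trans hn; apply: anti; exact: leq_addr.
  by rewrite sumr_const_nat subn0 -[leLHS]mulr_natr divfK.
- have [n0 h0] := dinf B; exists n0 => n /h0 hn; apply: le_trans hn _.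
  by rewrite ler_wpM2l.
Qed.

(** Induction on [k]: the correlation of [cis (u n)] at shift [h] is a phase of the same kind that
    needs one difference fewer, so van der Corput reduces the claim to Fejer's theorem. *)
Lemma mean_null_cis_iter k u : slow (iter k.+1 (@fdiff R) u) ->
  mean_null (fun n => cis (u n)).
Proof.
elim: k u => [|k ih] u hu; first exact: fejer_mean_null.
apply: van_der_corput => [n|h h0]; first by rewrite cmod_cis.
apply: (@eq_mean_null _ (fun n => cis (u (n + h)%N - u n))) => [n|].
  by rewrite cisB.
apply: ih; apply: eq_slow (slow_sum h0 hu) => n.
by rewrite iter_fdiff_shift fdiff_telescope.
Qed.

End Differencing.

(** * Finite differences of real powers *)

Section PowerPhase.
Variable R : realType.
Implicit Types (x a b c : R) (h : R -> R).

(** The analogue of [fdiff] on a real variable, so that the mean value theorem applies. *)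
Definition rdiff h x : R := h (x + 1) - h x.

(** The falling factorial, which is the coefficient in the [k]-th derivative of a power. *)
Fixpoint ffall a k : R := if k is k'.+1 then a * ffall (a - 1) k' else 1.

Lemma ffall_gt0 a k : k%:R - 1 < a -> 0 < ffall a k.
Proof.
elim: k a => //= k ih a ka; have := ler0n R k; rewrite -natr1 in ka => k0.
by apply: mulr_gt0; [lra|apply: ih; lra].
Qed.

(** The first [k] factors are positive and the last one, [a - k], is negative. *)
Lemma ffall_lt0 a k : k%:R - 1 < a < k%:R -> ffall a k.+1 < 0.
Proof.
elim: k a => [|k ih] a; first by rewrite /= mulr1 => /andP[].
rewrite -natr1 => /andP[h1 h2]; have := ler0n R k => k0.
have a0 : 0 < a by lra.
by rewrite [ffall _ _]/= pmulr_rlt0//; apply: ih; apply/andP; split; lra.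
Qed.

Lemma is_derive_rdiff h h' : (forall x, 0 < x -> is_derive x 1 h (h' x)) ->
  forall x, 0 < x -> is_derive x 1 (rdiff h) (rdiff h' x).
Proof.
move=> hh x x0.
have h1 : is_derive (x + 1) 1 h (h' (x + 1)) by apply: hh; lra.
have h2 : is_derive x 1 (fun y : R => y + 1) 1.
  by apply: is_derive_eq; rewrite addr0.
have h3 : is_derive x 1 (h \o (fun y : R => y + 1)) (h' (x + 1)).
  have := @is_derive1_comp R h (fun y => y + 1) x (h' (x + 1)) 1 h1 h2.
  by rewrite mulr1.
have := hh x x0 => h4.
exact: is_deriveB.
Qed.

Lemma is_derive_iter_rdiff k h h' : (forall x, 0 < x -> is_derive x 1 h (h' x)) ->
  forall x, 0 < x -> is_derive x 1 (iter k rdiff h) (iter k rdiff h' x).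
Proof. by move=> hh; elim: k => //= k ih; exact: is_derive_rdiff. Qed.

Lemma iter_rdiffZ k b h x :
  iter k rdiff (fun y => b * h y) x = b * iter k rdiff h x.
Proof. by elim: k x => //= k ih x; rewrite /rdiff !ih mulrBr. Qed.

(** The [k]-th difference is the [k]-th derivative at an intermediate point. Each step replaces the
    outermost difference by a derivative at some [z] in a unit interval; differentiation commutes
    with the remaining differences. *)
Lemma iter_rdiff_powR k a x : 0 < x ->
  exists2 y, x <= y <= x + k%:R &
    iter k rdiff (fun y => y `^ a) x = ffall a k * y `^ (a - k%:R).
Proof.
elim: k a x => [|k ih] a x x0.
  by exists x; rewrite ?addr0 ?lexx//= mul1r subr0.
have dv (z : R) : 0 < z -> is_derive z 1 (iter k rdiff (fun y => y `^ a))
    (iter k rdiff (fun y => a * y `^ (a - 1)) z).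
  by apply: is_derive_iter_rdiff => y y0; exact: is_derive1_powR.
have x1 : x < x + 1 by lra.
have ct : {within `[x, (x + 1)], continuous (iter k rdiff (fun y => y `^ a))}%classic.
  apply: derivable_within_continuous => z; rewrite in_itv/= => /andP[xz _].
  by have [] := dv z (lt_le_trans x0 xz).
have dv' z : z \in `]x, (x + 1)[ -> is_derive z 1 (iter k rdiff (fun y => y `^ a))
    (iter k rdiff (fun y => a * y `^ (a - 1)) z).
  by rewrite in_itv/= => /andP[xz _]; apply: dv; exact: lt_trans xz.
have [z] := MVT x1 dv' ct.
rewrite in_itv/= => /andP[xz zx].
rewrite addrAC subrr add0r mulr1 iter_rdiffZ => e.
have [y /andP[zy yz] e'] := ih (a - 1) z (lt_trans x0 xz).
exists y; first by rewrite -natr1; apply/andP; split; lra.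
rewrite [LHS]/= [LHS]e e' mulrA; congr (_ * _ `^ _).
by rewrite -natr1; ring.
Qed.

Lemma iter_fdiff_rdiff k h n :
  iter k (@fdiff R) (fun n => h n.+1%:R) n = iter k rdiff h n.+1%:R.
Proof. by elim: k n => //= k ih n; rewrite /fdiff /rdiff !ih natr1. Qed.

Lemma powR_unbounded a b : 0 < a -> exists n0 : nat, forall x, n0%:R <= x -> b <= x `^ a.
Proof.
move=> a0; have [n hn] := archimedean_nat (Num.max b 0 `^ a^-1); exists n => x nx.
have b0 : 0 <= Num.max b 0 by rewrite le_max lexx orbT.
apply: (@le_trans _ _ (Num.max b 0)); first by rewrite le_max lexx.
rewrite -[leLHS]powRr1// -(mulVf (lt0r_neq0 a0)) powRrM.
apply: ge0_ler_powR; rewrite ?nnegrE ?powR_ge0 ?(ltW a0)//.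
  exact: le_trans (ler0n _ _) nx.
exact: le_trans (hn n (leqnn n)) nx.
Qed.

(** The [k]-th difference at [n] is a positive constant times [y ^ (c - k)] with [y] between [n + 1]
    and [n + 1 + k]. As [c - k] lies strictly between -1 and 0, this tends to 0 while its product
    with [n] tends to infinity. *)
Lemma slow_powR c b k : 0 < b -> k%:R - 1 < c < k%:R ->
  slow (iter k (@fdiff R) (fun n => b * n.+1%:R `^ c)).
Proof.
move=> b0 hc; have /andP[kc ck] := hc.
have F0 : 0 < b * ffall c k by rewrite mulr_gt0 ?ffall_gt0.
pose d n := iter k (@fdiff R) (fun n => b * n.+1%:R `^ c) n.
have hd n : exists2 y : R, n.+1%:R <= y <= n.+1%:R + k%:R &
    d n = b * ffall c k * y `^ (c - k%:R).
  have [y hy e] := iter_rdiff_powR k c (ltr0Sn R n); exists y => //.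
  by rewrite /d (iter_fdiff_rdiff k (fun y => b * y `^ c)) iter_rdiffZ e mulrA.
have anti (y z : R) : 0 < y -> y <= z -> z `^ (c - k%:R) <= y `^ (c - k%:R).
  move=> y0 yz; have -> : c - k%:R = - (k%:R - c) by ring.
  rewrite !powRN lef_pV2 ?posrE ?powR_gt0//; last exact: lt_le_trans yz.
  by apply: ge0_ler_powR; rewrite ?nnegrE//; lra.
split=> [n|n|e e0|B]; rewrite -/(d _).
- have [y /andP[hy _] ->] := hd n; rewrite mulr_gt0// powR_gt0//.
  exact: lt_le_trans hy.
(* The sequence decreases because the next difference carries the negative factor [ffall c k.+1]. *)
- rewrite -/(d n) -subr_le0.
  have -> : d n.+1 - d n = b * iter k.+1 rdiff (fun y => y `^ c) n.+1%:R.
    by rewrite -iter_rdiffZ -iter_fdiff_rdiff.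
  have [y /andP[hy _] ->] := iter_rdiff_powR k.+1 c (ltr0Sn R n).
  rewrite pmulr_rle0// nmulr_rle0 ?ffall_lt0// powR_ge0//.
- have kc0 : 0 < k%:R - c by lra.
  have [n0 h0] := powR_unbounded (b * ffall c k / e) kc0.
  exists n0 => n hn; rewrite -/(d n); have [y /andP[hy _] ->] := hd n.
  have y0 : 0 < y by exact: lt_le_trans hy.
  have {}h0 : b * ffall c k / e <= y `^ (k%:R - c).
    by apply: h0; apply: le_trans hy; rewrite ler_nat leqW.
  have -> : c - k%:R = - (k%:R - c) by ring.
  rewrite powRN ler_pdivrMr ?powR_gt0//; move: h0.
  by rewrite ler_pdivrMr// [e * _]mulrC.
- have kc0 : 0 < c - k%:R + 1 by lra.
  have [n0 h0] := powR_unbounded (2 * B / (b * ffall c k)) kc0.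
  (* From [k.+1 <= n] follows [y <= n + 1 + k <= 2 * n], which explains the factor 2 in front of
     [B]. *)
  exists (maxn n0 k.+1) => n; rewrite geq_max => /andP[hn nk]; rewrite -/(d n).
  have [y /andP[hy hy'] ->] := hd n.
  have n1 : 0 < n.+1%:R :> R by [].
  have y0 : 0 < y by exact: lt_le_trans hy.
  have {}h0 : 2 * B / (b * ffall c k) <= y `^ (c - k%:R + 1).
    by apply: h0; apply: le_trans hy; rewrite ler_nat leqW.
  have yn : y <= 2 * n%:R.
    apply: le_trans hy' _; rewrite -natrD -natrM ler_nat; lia.
  move: h0; rewrite powRD ?gt_eqF ?implybT// powRr1 ?(ltW y0)// ler_pdivrMr//.
  have := powR_gt0 (c - k%:R) y0; set p := y `^ _; set q := b * _ in F0 * => p0 h0.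
  have : p * q * y <= p * q * (2 * n%:R) by rewrite ler_wpM2l// mulr_ge0// ltW.
  lra.
Qed.

Lemma mean_null_cis_powR c b : 0 < c -> ~ (exists k : int, c = k%:~R) -> b != 0 ->
  mean_null (fun n => cis (b * n%:R `^ c)).
Proof.
move=> c0 cnint b0.
have pos d : 0 < d -> mean_null (fun n => cis (d * n%:R `^ c)).
  (* The base becomes [n + 1], which is positive, so that the power is differentiable there. *)
  move=> d0; apply: mean_null_unshift1.
  have f0 : 0 <= Num.floor c by rewrite floor_ge0 ltW.
  (* [k + 1] differences are taken; [k < c] is strict because [c] is not an integer. *)
  pose k := `|Num.floor c|%N.
  have kE : k%:R = (Num.floor c)%:~R :> R by rewrite /k natr_absz ger0_norm.
  apply: (@mean_null_cis_iter _ k); apply: slow_powR => //.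
  rewrite -natr1 addrK kE; apply/andP; split; last first.
    by rewrite -[X in _ + X]mulr1z -rmorphD/= floorD1_gt.
  rewrite lt_neqAle floor_le ?num_real// andbT; apply/eqP => e.
  by apply: cnint; exists (Num.floor c).
have [b1|b1|b1] := ltgtP b 0; last by rewrite b1 eqxx in b0.
  have nb : 0 < - b by rewrite oppr_gt0.
  apply: eq_mean_null (mean_null_conj (pos _ nb)) => n.
  by rewrite -cisN mulNr opprK.
exact: pos.
Qed.

End PowerPhase.

(** * Multiplicative functions *)

Section ReciprocalPrimes.

Definition smooth K n := all (fun p => p <= K)%N (primes n).

(** Strip off one prime at a time: a prime not yet in [A] joins [A]; one already there leaves it and
    enters the square. *)
Lemma smooth_squarefree_square K n : (0 < n)%N -> smooth K n ->
  exists (A : {set 'I_K.+1}) (b : nat), n = ((\prod_(p in A) p) * b ^ 2)%N.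
Proof.
elim/ltn_ind: n => n ih n0 sn.
have [n1|n1] := leqP n 1.
  exists finset.set0, 1%N; rewrite big_set0; by case: n n0 n1 {ih sn} => [|[|]].
have [p pp pn] : exists2 p, prime p & (p %| n)%N.
  by exists (pdiv n); [exact: pdiv_prime|exact: pdiv_dvd].
have nE : n = (p * (n %/ p))%N by rewrite mulnC divnK.
have m0 : (0 < n %/ p)%N by rewrite divn_gt0 ?prime_gt0// dvdn_leq.
have mn : (n %/ p < n)%N by rewrite ltn_Pdiv ?prime_gt1.
have sm : smooth K (n %/ p).
  apply/allP => q; rewrite mem_primes => /and3P[qp _ qm].
  by move/allP: sn; apply; rewrite mem_primes qp n0 (dvdn_trans qm)// dvdn_div.
have pK : (p < K.+1)%N.
  by rewrite ltnS; move/allP: sn; apply; rewrite mem_primes pp n0.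
have [A [b mE]] := ih _ mn m0 sm.
have [iA|iA] := boolP (Ordinal pK \in A).
  exists (A :\ Ordinal pK), (p * b)%N; rewrite nE mE (big_setD1 _ iA) /=.
  ring.
exists (Ordinal pK |: A), b; by rewrite nE mE big_setU1//= mulnA.
Qed.

(** There are [2 ^ K.+1] choices of [A], and [b ^ 2 <= n <= s ^ 2] leaves [s + 1] choices of [b]. *)
Lemma smooth_count K s :
  (count (smooth K) (iota 1 (s ^ 2)) <= 2 ^ K.+1 * s.+1)%N.
Proof.
pose img := [seq ((\prod_(p in (A : {set 'I_K.+1})) p) * b ^ 2)%N |
  A <- enum {: {set 'I_K.+1}}, b <- iota 0 s.+1].
have sz : size img = (2 ^ K.+1 * s.+1)%N.
  by rewrite size_allpairs size_iota -cardE -cardsT -powersetT card_powerset cardsT card_ord.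
rewrite -sz -size_filter; apply: uniq_leq_size; first exact/filter_uniq/iota_uniq.
move=> n; rewrite mem_filter mem_iota add1n ltnS => /and3P[sn n0 ns].
have [A [b nE]] := smooth_squarefree_square n0 sn.
apply/allpairsPdep; exists A, b; split=> //; first by rewrite mem_enum.
rewrite mem_iota /= add0n ltnS -(@leq_exp2r _ _ 2)//; apply: leq_trans ns.
by rewrite nE leq_pmull//; move: n0; rewrite nE muln_gt0 => /andP[].
Qed.

(** Erdos's argument: every [n] from 1 to [N] is either [K]-smooth or divisible by a prime of the
    block. With a sum below 1/2 the second kind would number fewer than [N / 2], while the first
    kind number at most [N / 2]. *)
Lemma reciprocal_primes_block (R : realFieldType) K : exists M,
  1 / 2 <= \sum_(p <- iota K.+1 M | prime p) (p%:R^-1 : R).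
Proof.
(* With this [s], twice the smooth count [2 ^ K.+1 * s.+1] equals [s * (s + 1) / 2], hence is at
   most [s ^ 2]. *)
pose s := (2 ^ K.+3)%N; pose N := (s ^ 2)%N; exists N.
pose P := iota K.+1 N.
have cnt : (N <= 2 ^ K.+1 * s.+1 + \sum_(p <- P | prime p) N %/ p)%N.
  apply: leq_trans (leq_add (smooth_count K s) (leqnn _)).
  rewrite -sum1_count -{1}(size_iota 1 N) -sum1_size -/N (big_mkcond (smooth K)) /=.
  under [X in (_ <= _ + X)%N]eq_bigr do rewrite divn_count_dvd /index_iota subSS subn0.
  rewrite (exchange_big_dep xpredT)//= -big_split/= big_seq [leqRHS]big_seq.
  apply: leq_sum => n; rewrite mem_iota add1n ltnS => /andP[n0 nN].
  case: ifPn => // /allPn[p]; rewrite mem_primes -ltnNge => /and3P[pp _ pn] Kp.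
  have pP : p \in P by rewrite mem_iota Kp addSn ltnS (leq_trans (dvdn_leq n0 pn))// (leq_trans nN)// leq_addl.
  rewrite add0n big_mkcond/= (bigD1_seq p) ?iota_uniq//= pp pn.
  by rewrite leq_addr.
rewrite leNgt; apply/negP => lt12.
have N0 : 0 < N%:R :> R by rewrite ltr0n !expn_gt0.
have le1 : (\sum_(p <- P | prime p) N %/ p)%:R <=
    N%:R * \sum_(p <- P | prime p) (p%:R^-1 : R).
  rewrite natr_sum mulr_sumr; apply: ler_sum => p pp.
  by rewrite ler_pdivlMr ?ltr0n ?prime_gt0// -natrM ler_nat leq_divM.
have le2 : N%:R <= (2 ^ K.+1 * s.+1)%:R + (\sum_(p <- P | prime p) N %/ p)%:R :> R.
  by rewrite -natrD ler_nat.
have le3 : 2 * (2 ^ K.+1 * s.+1)%:R <= N%:R :> R.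
  rewrite -natrM ler_nat /N /s !expnS expn0 muln1.
  have : (0 < 2 ^ K)%N by rewrite expn_gt0.
  nia.
have : N%:R * \sum_(p <- P | prime p) (p%:R^-1 : R) < N%:R * (1 / 2).
  by rewrite ltr_pM2l.
lra.
Qed.

Lemma reciprocal_primes_unbounded (R : archiRealFieldType) (B : R) K :
  exists P : seq nat, [/\ uniq P, forall p, p \in P -> prime p && (K < p)%N &
    B <= \sum_(p <- P) p%:R^-1].
Proof.
(* Concatenating [j] successive disjoint blocks gives at least [j / 2]. *)
have half j : exists P : seq nat, [/\ uniq P, forall p, p \in P -> prime p && (K < p)%N &
    j%:R / 2 <= \sum_(p <- P) (p%:R^-1 : R)].
  elim: j K => [|j ih] {}K; first by exists [::]; rewrite big_nil mul0r.
  have [M hM] := reciprocal_primes_block R K.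
  have [P [uP hP sP]] := ih (K + M)%N.
  exists ([seq p <- iota K.+1 M | prime p] ++ P); split.
  - rewrite cat_uniq filter_uniq ?iota_uniq//= uP andbT.
    apply/hasPn => p /hP /andP[_ Kp]; rewrite mem_filter mem_iota; lia.
  - move=> p; rewrite mem_cat mem_filter mem_iota => /orP[/and3P[-> ->]//|].
    by move=> /hP /andP[-> ?]/=; lia.
  - rewrite big_cat big_filter/= -natr1; lra.
have [P [uP hP sP]] := half (Num.bound (2 * `|B|)); exists P; split=> //.
apply: le_trans sP; rewrite ler_pdivlMr// mulrC.
apply: le_trans (ltW (archi_boundP _)); last by rewrite mulr_ge0.
by rewrite ler_pM2l// ler_norm.
Qed.

End ReciprocalPrimes.

(** * Counting multiples *)

Section DivisorCount.

(* This is [N / d] rounded up. *)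
Definition cdiv N d := (\sum_(0 <= n < N) (d %| n))%N.

Lemma cdivS N d : cdiv N.+1 d = (cdiv N d + (d %| N))%N.
Proof. by rewrite /cdiv big_nat_recr. Qed.

Lemma mulnI_bounds d k l : (0 < d)%N -> (d * k <= d * l < d * k + d)%N -> l = k.
Proof.
by move=> d0; rewrite addnC -mulnS ltn_pmul2l// leq_pmul2l// ltnS -eqn_leq => /eqP.
Qed.

Lemma cdiv_bounds N d : (0 < d)%N -> (N <= d * cdiv N d < N + d)%N.
Proof.
move=> d0; elim: N => [|N ih]; first by rewrite /cdiv big_geq// muln0.
rewrite cdivS; case: (boolP (d %| N)%N) => [/dvdnP[k kE]|nd].
  move: ih; rewrite kE [(k * d)%N]mulnC => /(mulnI_bounds d0) ->.
  by rewrite addn1 mulnS; lia.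
have : (d * cdiv N d != N)%N by apply: contra nd => /eqP <-; exact: dvdn_mulr.
by move: ih; rewrite addn0; lia.
Qed.

Lemma cdiv_dvd N d : (0 < d)%N -> (d %| N)%N -> (d * cdiv N d)%N = N.
Proof.
move=> d0 /dvdnP[k kE]; have := cdiv_bounds N d0.
by move=> h; rewrite (@mulnI_bounds d k (cdiv N d))// mulnC -kE.
Qed.

Lemma cdiv_leq N d : (cdiv N d <= N)%N.
Proof.
elim: N => [|N ih]; first by rewrite /cdiv big_geq.
by rewrite cdivS -addn1 leq_add// leq_b1.
Qed.

Lemma sum_multiples (V : nmodType) (F : nat -> V) N d : (0 < d)%N ->
  \sum_(0 <= n < N | (d %| n)%N) F n = \sum_(0 <= m < cdiv N d) F (d * m)%N.
Proof.
move=> d0; elim: N => [|N ih]; first by rewrite /cdiv !big_geq.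
rewrite big_mkcond big_nat_recr//= -big_mkcond/= ih cdivS.
case: ifP => dN; last by rewrite addn0 addr0.
by rewrite addn1 big_nat_recr//= cdiv_dvd.
Qed.

Lemma cdiv_real_bounds (R : realFieldType) N d : (0 < d)%N ->
  N%:R / d%:R <= ((cdiv N d)%:R : R) <= N%:R / d%:R + 1.
Proof.
move=> d0; have d0' : 0 < d%:R :> R by rewrite ltr0n.
have /andP[h1 h2] := cdiv_bounds N d0; apply/andP; split.
  by rewrite ler_pdivrMr// mulrC -natrM ler_nat.
have -> : N%:R / d%:R + 1 = (N + d)%:R / d%:R :> R.
  by rewrite natrD; field; rewrite gt_eqF.
by rewrite ler_pdivlMr// mulrC -natrM ler_nat ltnW.
Qed.

End DivisorCount.

(** * The Turan-Kubilius inequality for a finite set of primes *)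

Section TuranKubilius.
Variables (R : realFieldType) (P : seq nat).
Hypotheses (uP : uniq P) (primeP : forall p, p \in P -> prime p).

Let A : R := \sum_(p <- P) p%:R^-1.
Let om n : R := \sum_(p <- P) (p %| n)%:R.

(** After expanding the square, the second moment counts multiples of [p] and of [p * q], each up to
    an error of at most 1. The first moment enters with a negative sign, so its lower bound [lin]
    suffices. *)
Lemma turan_kubilius N : \sum_(0 <= n < N) (om n - A) ^+ 2 <=
  A * N%:R + (size P)%:R + (size P)%:R ^+ 2.
Proof.
have A0 : 0 <= A by apply: sumr_ge0 => p _; rewrite invr_ge0.
have lin : N%:R * A <= \sum_(0 <= n < N) om n.
  rewrite exchange_big /= mulr_sumr big_seq [leRHS]big_seq; apply: ler_sum => p /primeP pp.
  by rewrite -natr_sum; case/andP: (cdiv_real_bounds R N (prime_gt0 pp)).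
have cst : \sum_(p <- P) (1 : R) = (size P)%:R.
  by rewrite big_const_seq count_predT iter_addr addr0.
have sq : \sum_(0 <= n < N) om n ^+ 2 <=
    N%:R * A + (size P)%:R + (N%:R * A ^+ 2 + (size P)%:R ^+ 2).
  have -> : \sum_(0 <= n < N) om n ^+ 2 =
     \sum_(p <- P) \sum_(q <- P) \sum_(0 <= n < N) (p %| n)%:R * (q %| n)%:R.
    under [RHS]eq_bigr do rewrite exchange_big/=.
    rewrite [RHS]exchange_big /=; apply: eq_bigr => n _.
    by rewrite expr2 big_distrlr.
  rewrite sum_diagE//; apply: lerD.
    rewrite mulr_sumr -cst -big_split/= big_seq [leRHS]big_seq.
    apply: ler_sum => p /primeP pp.
    under eq_bigr do rewrite -natrM mulnb andbb.
    by rewrite -natr_sum; case/andP: (cdiv_real_bounds R N (prime_gt0 pp)).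
  (* The nonnegative diagonal terms are put back, so that the double sum factors as [A ^+ 2]. *)
  have -> : N%:R * A ^+ 2 + (size P)%:R ^+ 2 =
      \sum_(p <- P) \sum_(q <- P) (N%:R / (p * q)%:R + 1) :> R.
    under eq_bigr do rewrite big_split/=.
    rewrite big_split/= cst; congr (_ + _); last first.
      by rewrite big_const_seq count_predT iter_addr addr0 expr2 mulr_natr.
    rewrite expr2 big_distrlr/= mulr_sumr; apply: eq_bigr => p _.
    by rewrite mulr_sumr; apply: eq_bigr => q _; rewrite natrM invfM.
  rewrite big_seq [leRHS]big_seq; apply: ler_sum => p pP.
  rewrite [leRHS](bigID (fun q => q != p))/= -[leLHS]addr0; apply: lerD; last first.
    by apply: sumr_ge0 => q _; rewrite addr_ge0// mulr_ge0// invr_ge0.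
  rewrite big_seq_cond [leRHS]big_seq_cond; apply: ler_sum => q /andP[qP qp].
  have pp := primeP pP; have qq := primeP qP.
  have cpq : coprime p q.
    by rewrite prime_coprime// dvdn_prime2// eq_sym.
  under eq_bigr do rewrite -natrM mulnb -Gauss_dvd//.
  have pq0 : (0 < p * q)%N by rewrite muln_gt0 !prime_gt0.
  by rewrite -natr_sum; case/andP: (cdiv_real_bounds R N pq0).
have -> : \sum_(0 <= n < N) (om n - A) ^+ 2 =
   \sum_(0 <= n < N) om n ^+ 2 - 2 * A * \sum_(0 <= n < N) om n + N%:R * A ^+ 2.
  rewrite mulr_sumr -sumrB.
  have -> : N%:R * A ^+ 2 = \sum_(0 <= n < N) A ^+ 2.
    by rewrite sumr_const_nat subn0 mulr_natl.
  by rewrite -big_split/=; apply: eq_bigr => n _; ring.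
move: sq lin; set S2 := \sum_(0 <= n < N) _; set S1 := \sum_(0 <= n < N) _.
move=> sq lin; have : A * (N%:R * A) <= A * S1 by rewrite ler_wpM2l.
nra.
Qed.

End TuranKubilius.

(** * Katai's orthogonality criterion *)

Section Katai.
Variable R : realType.
Variables (f g : nat -> R[i]).
Hypothesis fM : forall p m, prime p -> ~~ (p %| m)%N -> f (p * m)%N = f p * f m.
Hypothesis f1 : forall n, cmod (f n) <= 1.
Hypothesis g1 : forall n, cmod (g n) <= 1.
Hypothesis gcorr : forall p q, prime p -> prime q -> p != q ->
  mean_null (fun n => g (p * n)%N * (g (q * n)%N)^*%C).

Lemma eventually_all (I : eqType) (r : seq I) (Q : I -> nat -> Prop) :
  (forall i, i \in r -> exists N0, forall N, (N0 <= N)%N -> Q i N) ->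
  exists N0, forall N, (N0 <= N)%N -> forall i, i \in r -> Q i N.
Proof.
elim: r => [|i r ih] h; first by exists 0%N.
have [N1 h1] := h i (mem_head _ _).
have [N2 h2] := ih (fun j jr => h j (mem_behead (s := i :: r) jr)).
exists (maxn N1 N2) => N; rewrite geq_max => /andP[/h1 {}h1 /h2 {}h2] j.
by rewrite inE => /predU1P[->//|]; exact: h2.
Qed.

Section FixedPrimes.
Variables (P : seq nat) (K : nat).
Hypotheses (uP : uniq P) (pP : forall p, p \in P -> prime p && (K < p)%N).

Let A : R := \sum_(p <- P) p%:R^-1.
Let s : R := (size P)%:R.
Let om n : R := \sum_(p <- P) (p %| n)%:R.

Let prP p : p \in P -> prime p.
Proof. by move=> /pP /andP[]. Qed.

(** The inner sum of the bilinear form. The condition [m < cdiv N p] says [p * m < N], and lets [m]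
    run over one range common to all [p]. *)
Let W N m : R[i] := \sum_(p <- P) (if (m < cdiv N p)%N then f p * g (p * m)%N else 0).

Lemma const_sum_seq (x : R) : \sum_(p <- P) x = s * x.
Proof. by rewrite big_const_seq count_predT iter_addr addr0 /s mulr_natl. Qed.

(** The diagonal gives at most [A * N + s]; each off-diagonal pair is a correlation sum of [g], at
    most [eta * N]. *)
Lemma katai_window_sqr : 0 < A -> exists N0, forall N, (N0 <= N)%N ->
  \sum_(0 <= m < N) cmod (W N m) ^+ 2 <= 2 * A * N%:R.
Proof.
move=> A0; have s0 : 0 <= s by rewrite ler0n.
(* Chosen so that the at most [s ^+ 2] pairs together contribute at most [A / 2 * N]. *)
pose eta := A / (2 * (s ^+ 2 + 1)).
have s1 : 0 < s ^+ 2 + 1 by rewrite ltr_wpDl ?sqr_ge0.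
have eta0 : 0 < eta by rewrite divr_gt0// mulr_gt0.
have A20 : 0 < A / 2 by lra.
have [N1 h1] := archimedean_nat_mul s A20.
(* All cut-offs [M <= N] are covered at once, because the one used below, the smaller of [cdiv N p]
   and [cdiv N q], varies with [N]. *)
have ev (pq : nat * nat) : pq \in [seq (p, q) | p <- P, q <- P] ->
    exists N0, forall N, (N0 <= N)%N -> pq.1 != pq.2 -> forall M, (M <= N)%N ->
    cmod (\sum_(0 <= m < M) g (pq.1 * m)%N * (g (pq.2 * m)%N)^*%C) <= eta * N%:R.
  case/allpairsP => -[p q] /= [hp hq ->] /=.
  have [->|npq] := eqVneq p q; first by exists 0%N.
  have [N0 h0] := mean_null_partial (gcorr (prP hp) (prP hq) npq) eta0.
  by exists N0 => N N0N _ M MN; exact: h0.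
have [N2 {ev}h2] := eventually_all ev.
exists (maxn N1 N2) => N; rewrite geq_max => /andP[/h1 {}h1 /h2 {}h2].
have S0 : 0 <= \sum_(0 <= m < N) cmod (W N m) ^+ 2.
  by apply: sumr_ge0 => m _; exact: sqr_ge0.
rewrite -(ger0_norm S0) -cmod_real rmorph_sum/=.
under eq_bigr do rewrite cmod_sum_sqr sum_diagE//.
rewrite big_split/=; apply: le_trans (cmodD _ _) _.
set D := cmod _; set O := cmod _.
have cut (F : nat -> R[i]) M : (M <= N)%N ->
    \sum_(0 <= m < N) (if (m < M)%N then F m else 0) = \sum_(0 <= m < M) F m.
  move=> MN; rewrite (big_cat_nat (n := M))//= [X in _ + X]big_nat [X in _ + X]big1 ?addr0.
    by rewrite big_nat [RHS]big_nat; apply: eq_bigr => m /andP[_ ->].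
  by move=> m /andP[Mm _]; rewrite ltnNge Mm.
have hD : D <= A * N%:R + s.
  rewrite /D exchange_big/=; apply: le_trans (cmod_sum _ _ _) _.
  have -> : A * N%:R + s = \sum_(p <- P) (N%:R / p%:R + 1).
    by rewrite big_split/= const_sum_seq mulr1 -mulr_sumr [A * _]mulrC.
  rewrite big_seq [leRHS]big_seq; apply: ler_sum => p hp.
  have hc : (cdiv N p - 0)%:R <= N%:R / p%:R + 1 :> R.
    by rewrite subn0; case/andP: (cdiv_real_bounds R N (prime_gt0 (prP hp))).
  apply: le_trans hc; rewrite -[leRHS]mul1r.
  rewrite (eq_bigr (fun m => if (m < cdiv N p)%N
     then f p * g (p * m)%N * (f p * g (p * m)%N)^*%C else 0)); last first.
    by move=> m _; case: ifP => // _; rewrite mul0r.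
  rewrite cut ?cdiv_leq//; apply: cmod_sum_nat_le => // m _.
  rewrite cmodM cmodJ cmodM.
  have fg : cmod (f p) * cmod (g (p * m)%N) <= 1.
    by rewrite -[1]mulr1 ler_pM ?cmod_ge0.
  by rewrite -[1]mulr1 ler_pM// mulr_ge0// cmod_ge0.
have hO : O <= s * (s * (eta * N%:R)).
  rewrite /O exchange_big/=; apply: le_trans (cmod_sum _ _ _) _.
  rewrite -const_sum_seq big_seq [leRHS]big_seq; apply: ler_sum => p hp.
  rewrite exchange_big/=; apply: le_trans (cmod_sum _ _ _) _.
  rewrite -const_sum_seq [leRHS](bigID (fun q => q != p))/= -[leLHS]addr0.
  have en0 : 0 <= eta * N%:R by rewrite mulr_ge0// ltW.
  apply: lerD; last by apply: sumr_ge0 => q _.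
  rewrite big_seq_cond [leRHS]big_seq_cond; apply: ler_sum => q /andP[hq qp].
  pose M := minn (cdiv N p) (cdiv N q).
  have MN : (M <= N)%N by rewrite geq_min cdiv_leq.
  rewrite (eq_bigr (fun m => if (m < M)%N
     then f p * (f q)^*%C * (g (p * m)%N * (g (q * m)%N)^*%C) else 0)); last first.
    move=> m _; rewrite leq_min; case: ifP => _; last by rewrite mul0r.
    rewrite andTb; case: ifP => _; last by rewrite conjc0 mulr0.
    by rewrite rmorphM/=; ring.
  rewrite cut// -mulr_sumr !cmodM cmodJ.
  have := h2 (p, q) (allpairs_f _ hp hq); rewrite /= eq_sym => /(_ qp M MN) hM.
  apply: le_trans hM; rewrite ler_piMl ?cmod_ge0//.
  by rewrite -[1]mulr1 ler_pM ?cmod_ge0.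
have ee : eta * (s ^+ 2 + 1) = A / 2 by rewrite /eta; field; rewrite gt_eqF.
have N0 : 0 <= N%:R :> R by [].
have : s * (s * (eta * N%:R)) <= A / 2 * N%:R.
  have -> : s * (s * (eta * N%:R)) = s ^+ 2 * eta * N%:R by ring.
  by rewrite ler_wpM2r//; nra.
lra.
Qed.

Lemma katai_reindex N :
  \sum_(0 <= n < N) (f n * g n) * ((om n)%:C)%C =
  \sum_(p <- P) \sum_(0 <= m < cdiv N p) f (p * m)%N * g (p * m)%N.
Proof.
rewrite /om; under eq_bigr do rewrite rmorph_sum mulr_sumr/=.
rewrite exchange_big/= big_seq [RHS]big_seq; apply: eq_bigr => p hp.
rewrite -(sum_multiples (fun n => f n * g n))//; last exact: prime_gt0 (prP hp).
rewrite [RHS]big_mkcond; apply: eq_bigr => n _.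
by case: (p %| n)%N; rewrite ?rmorph1 ?rmorph0 ?mulr1 ?mulr0.
Qed.

(** With [m] outermost, [f m] is bounded by 1 and only the moduli of [W N m] remain to be summed. *)
Lemma katai_main_term N :
  \sum_(p <- P) \sum_(0 <= m < cdiv N p) f p * f m * g (p * m)%N =
  \sum_(0 <= m < N) f m * W N m.
Proof.
under [RHS]eq_bigr do rewrite mulr_sumr.
rewrite [RHS]exchange_big/=; apply: eq_bigr => p _.
rewrite [RHS](big_cat_nat (n := cdiv N p)) ?cdiv_leq//=.
rewrite [X in _ + X]big_nat [X in _ + X]big1 ?addr0; last first.
  by move=> m /andP[pm _]; rewrite ltnNge pm mulr0.
rewrite big_nat [RHS]big_nat; apply: eq_bigr => m /andP[_ ->].
by ring.
Qed.

(** The difference vanishes unless [p] divides [m], that is, [p * p] divides [p * m]. There are at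
    most [N / (p * p) + 1] such [m], and [1 / p <= 1 / K]. *)
Lemma katai_error N : (0 < K)%N ->
  cmod (\sum_(p <- P) \sum_(0 <= m < cdiv N p)
    (f (p * m)%N * g (p * m)%N - f p * f m * g (p * m)%N)) <=
  2 * (A * N%:R / K%:R) + 2 * s.
Proof.
move=> K0; apply: le_trans (cmod_sum _ _ _) _.
have -> : 2 * (A * N%:R / K%:R) + 2 * s =
    \sum_(p <- P) 2 * (N%:R / K%:R / p%:R + 1).
  by rewrite -mulr_sumr big_split/= const_sum_seq mulr1 -mulr_sumr -/A; ring.
rewrite big_seq [leRHS]big_seq; apply: ler_sum => p hp.
have /andP[pp Kp] := pP hp; have p0 := prime_gt0 pp.
have term m : cmod (f (p * m)%N * g (p * m)%N - f p * f m * g (p * m)%N) <=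
    2 * (p %| m)%:R.
  case: (boolP (p %| m)%N) => [_|npm]; last by rewrite fM// subrr cmod0 mulr0.
  rewrite -mulrBl cmodM mulr1; have := cmodB (f (p * m)%N) (f p * f m).
  rewrite cmodM; have := f1 (p * m)%N; have := f1 p; have := f1 m; have := g1 (p * m)%N.
  have := cmod_ge0 (f p); have := cmod_ge0 (f m); have := cmod_ge0 (g (p * m)%N).
  set a := cmod (f _ - _); set b := cmod (f p); set c := cmod (f m); set d := cmod (g _).
  move=> d0 c0 b0 d1 c1 b1 e1 h.
  have : b * c <= 1 by rewrite -[1]mulr1 ler_pM.
  have a0 : 0 <= a by exact: cmod_ge0.
  by nra.
apply: le_trans (cmod_sum _ _ _) _; apply: le_trans (ler_sum _ (fun m _ => term m)) _.
rewrite -mulr_sumr ler_pM2l//.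
have K0' : 0 < K%:R :> R by rewrite ltr0n.
have p0' : 0 < p%:R :> R by rewrite ltr0n.
rewrite -natr_sum -/(cdiv (cdiv N p) p).
have b1 : (cdiv (cdiv N p) p <= cdiv N (p * p))%N.
  have pp0 : (0 < p * p)%N by rewrite muln_gt0 p0.
  have /andP[c1 _] := cdiv_bounds N pp0.
  have /andP[_ c2] := cdiv_bounds N p0.
  have /andP[_ c3] := cdiv_bounds (cdiv N p) p0.
  rewrite -ltnS -(ltn_pmul2l pp0) -mulnA.
  have : (cdiv N p <= p * cdiv N (p * p))%N.
    by rewrite -ltnS -(ltn_pmul2l p0) mulnS; nia.
  nia.
apply: (@le_trans _ _ (cdiv N (p * p))%:R); first by rewrite ler_nat.
have pp0 : (0 < p * p)%N by rewrite muln_gt0 p0.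
have /andP[_ h2] := cdiv_real_bounds R N pp0.
apply: le_trans h2 _; rewrite lerD2r natrM invfM mulrA.
by rewrite ler_pM2r ?invr_gt0// ler_wpM2l// lef_pV2 ?posrE// ler_nat ltnW.
Qed.

End FixedPrimes.

(** [A] times the sum splits into the deviation of [om] from its mean [A], the failure of
    multiplicativity, and a bilinear sum. Turan-Kubilius, [katai_error] and [katai_window_sqr] bound
    these in turn. *)
Lemma katai_orthogonality : mean_null (fun n => f n * g n).
Proof.
(* In units of [d * A * N] the deviation costs 1, the bilinear sum 1, and the multiplicativity error
   2 + 1, hence 5 in all. *)
move=> e e0; pose d := e / 5; have d0 : 0 < d by rewrite /d; lra.
have [K hK] := archimedean_nat (1 / d).
have {hK}Kd : 1 / d <= K.+1%:R by apply: hK.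
(* [2 / d ^+ 2] is what [mean_square_bound] requires of [A]; primes above [1 / d] make [katai_error]
   small. *)
have [P [uP hP hA]] := reciprocal_primes_unbounded (2 / d ^+ 2) K.+1.
set A := \sum_(p <- P) _ in hA.
have A0 : 0 < A by rewrite (lt_le_trans _ hA)// divr_gt0// exprn_gt0.
pose s : R := (size P)%:R; have s0 : 0 <= s by rewrite ler0n.
have prP p : p \in P -> prime p by move=> /hP /andP[].
have [N1 h1] := katai_window_sqr uP hP A0.
have [N2 h2] := archimedean_nat_mul (s + s ^+ 2) A0.
have [N3 h3] := archimedean_nat_mul (2 * s) (mulr_gt0 d0 A0).
exists (maxn N1 (maxn N2 N3)) => N.
rewrite !geq_max => /and3P[/h1{}h1 /h2{}h2 /h3{}h3].
pose om n : R := \sum_(p <- P) (p %| n)%:R.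
have tk : \sum_(0 <= n < N) `|om n - A| <= d * A * N%:R.
  apply: mean_square_bound => //.
  under eq_bigr do rewrite real_normK ?num_real//.
  apply: le_trans (turan_kubilius R uP prP N) _; rewrite -/A -/s; lra.
have w := mean_square_bound d0 hA h1.
have er := katai_error uP hP N (ltn0Sn K).
have t1 : cmod (\sum_(0 <= n < N) f n * g n * ((A - om n)%:C)%C) <= d * A * N%:R.
  apply: le_trans (cmod_sum _ _ _) _; apply: le_trans tk; apply: ler_sum => n _.
  rewrite cmodM cmod_real distrC cmodM ler_piMl//.
  by rewrite -[1]mulr1 ler_pM ?cmod_ge0.
rewrite -/A -/s in er.
have t3 : cmod (\sum_(p <- P) \sum_(0 <= m < cdiv N p) f p * f m * g (p * m)%N) <= d * A * N%:R.
  rewrite katai_main_term; apply: le_trans (cmod_sum _ _ _) _; apply: le_trans w.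
  by apply: ler_sum => m _; rewrite cmodM ler_piMl ?cmod_ge0.
have decomp : (A%:C)%C * \sum_(0 <= n < N) f n * g n =
  \sum_(0 <= n < N) f n * g n * ((A - om n)%:C)%C +
  (\sum_(p <- P) \sum_(0 <= m < cdiv N p)
    (f (p * m)%N * g (p * m)%N - f p * f m * g (p * m)%N) +
  \sum_(p <- P) \sum_(0 <= m < cdiv N p) f p * f m * g (p * m)%N).
  rewrite -big_split/=.
  have -> : \sum_(p <- P)
     (\sum_(0 <= m < cdiv N p)
         (f (p * m)%N * g (p * m)%N - f p * f m * g (p * m)%N) +
      \sum_(0 <= m < cdiv N p) f p * f m * g (p * m)%N) =
      \sum_(p <- P) \sum_(0 <= m < cdiv N p) f (p * m)%N * g (p * m)%N.
    by apply: eq_bigr => p _; rewrite -big_split/=; apply: eq_bigr => m _; rewrite subrK.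
  rewrite -(katai_reindex hP) -big_split/= mulr_sumr; apply: eq_bigr => n _.
  by rewrite rmorphB/= -/(om n); ring.
have : A * cmod (\sum_(0 <= n < N) f n * g n) <= A * (e * N%:R).
  rewrite -{1}(gtr0_norm A0) -cmod_real -cmodM decomp.
  apply: le_trans (cmodD _ _) _; apply: le_trans (lerD t1 (le_trans (cmodD _ _) (lerD er t3))) _.
  have Kinv : K.+1%:R^-1 <= d.
    by rewrite -[leLHS]mul1r ler_pdivrMr ?ltr0n// mulrC -ler_pdivrMr.
  have hk : A * N%:R / K.+1%:R <= A * N%:R * d by rewrite ler_wpM2l// mulr_ge0// ltW.
  have -> : e = 5 * d by rewrite /d; field.
  move: h3 hk; clear; set k := K.+1%:R^-1; set n := N%:R; move: A d s n k.
  by move=> A d s n k; lra.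
by rewrite ler_pM2l.
Qed.

End Katai.

(** * Fejer kernels and step functions *)

Section FejerKernel.
Variable R : realType.
Implicit Types t x : R.

(** The Fejer kernel normalized to constant coefficient 1, written as a square so that it is visibly
    nonnegative. *)
Definition fejer_kernel (Q : nat) t : R :=
  Q%:R^-1 * cmod (\sum_(0 <= j < Q) cis (j%:R * t)) ^+ 2.
Local Notation fk := fejer_kernel.

Lemma fejer_kernel_ge0 Q t : 0 <= fk Q t.
Proof. by rewrite mulr_ge0 ?invr_ge0// sqr_ge0. Qed.

Lemma fejer_kernelE Q t : (0 < Q)%N -> ((fk Q t)%:C)%C = 1 +
  ((Q%:R^-1)%:C)%C * \sum_(0 <= j < Q) \sum_(0 <= k < Q | k != j) cis ((j%:R - k%:R) * t).
Proof.
move=> Q0; rewrite rmorphM/= cmod_sum_sqr sum_diagE ?iota_uniq// mulrDr; congr (_ + _ * _).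
  under eq_bigr do rewrite -cisB subrr cis0.
  rewrite sumr_const_nat subn0 -(rmorph_nat (real_complex R)) -rmorphM/= mulVf//.
  by rewrite pnatr_eq0 -lt0n.
by apply: eq_bigr => j _; apply: eq_bigr => k _; rewrite -cisB mulrBl.
Qed.

Lemma fejer_kernel_period Q t (a : int) : fk Q (t + a%:~R * (2 * pi)) = fk Q t.
Proof.
congr (_ * cmod _ ^+ 2); apply: eq_bigr => j _; rewrite mulrDr cisD mulrA.
have -> : j%:R * a%:~R = (j%:Z * a)%:~R :> R by rewrite rmorphM.
by rewrite cis_2piM mulr1.
Qed.

Lemma cis_neq1 x : 0 < `|x| < 2 * pi -> cis x != 1.
Proof.
move=> /andP[x0 x2]; apply/eqP => -[]; rewrite -cos_norm.
have -> : `|x| = (`|x| / 2) *+ 2 by rewrite -mulr_natr; field.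
rewrite cos_mulr2n cos2sin2 -mulr_natr => e _.
have : 0 < sin (`|x| / 2) by apply: sin_gt0_pi; apply/andP; split; lra.
by move=> s0; nra.
Qed.

(** Averaging over [Q] equally spaced shifts kills every frequency [j - k] with [0 < |j - k| < Q]:
    each gives a geometric sum of a [Q]-th root of unity [z] other than 1. *)
Lemma fejer_kernel_partition Q t : (0 < Q)%N ->
  \sum_(0 <= q < Q) fk Q (t - q%:R * (2 * pi / Q%:R)) = Q%:R.
Proof.
move=> Q0; apply: (@complexI R); rewrite rmorph_sum/=.
have Q0' : 0 < Q%:R :> R by rewrite ltr0n.
under eq_bigr do rewrite fejer_kernelE//.
rewrite big_split/= sumr_const_nat subn0 -mulr_sumr -(rmorph_nat (real_complex R)).
rewrite -[RHS]addr0; congr (_ + _).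
rewrite exchange_big big_nat big1 ?mulr0// => j jQ.
rewrite exchange_big /= big_nat_cond big1 // => k /andP[/andP[_ kQ] kj].
have jk0 : `|j%:R - k%:R| < Q%:R :> R /\ 0 < `|j%:R - k%:R| :> R.
  split; last by rewrite normr_gt0 subr_eq0 eqr_nat eq_sym.
  have : j%:R < Q%:R :> R by rewrite ltr_nat; case/andP: jQ.
  have : k%:R < Q%:R :> R by rewrite ltr_nat.
  have := ler0n R j; have := ler0n R k; rewrite ltr_norml; move=> *; apply/andP; split; lra.
case: jk0 => jk1 jk0.
pose z : R[i] := cis (- ((j%:R - k%:R) * (2 * pi / Q%:R))).
have z1 : z != 1.
  apply: cis_neq1; rewrite normrN normrM (gtr0_norm (x := 2 * pi / Q%:R)); last first.
    by rewrite divr_gt0// mulr_gt0// pi_gt0.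
  apply/andP; split; first by rewrite mulr_gt0// divr_gt0// mulr_gt0// pi_gt0.
  rewrite mulrA ltr_pdivrMr// [ltRHS]mulrC ltr_pM2r// mulr_gt0// pi_gt0//.
have zQ : z ^+ Q = 1.
  rewrite -cisMn; have -> : Q%:R * - ((j%:R - k%:R) * (2 * pi / Q%:R)) =
      (k%:Z - j%:Z)%:~R * (2 * pi) :> R by rewrite rmorphB/=; field; rewrite gt_eqF.
  exact: cis_2piM.
have -> : \sum_(0 <= q < Q) cis ((j%:R - k%:R) * (t - q%:R * (2 * pi / Q%:R))) =
    cis ((j%:R - k%:R) * t) * \sum_(0 <= q < Q) z ^+ q.
  rewrite mulr_sumr; apply: eq_bigr => q _; rewrite -cisMn -cisD; congr cis; ring.
have : (z - 1) * \sum_(0 <= q < Q) z ^+ q = 0.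
  by rewrite big_mkord -subrX1 zQ subrr.
by move/eqP; rewrite mulf_eq0 subr_eq0 (negbTE z1)/= => /eqP ->; rewrite mulr0.
Qed.

(** The exponential sum is geometric, so multiplying it by [cis t - 1] leaves modulus at most 2. *)
Lemma fejer_kernel_far Q t kap : (0 < Q)%N -> 0 < kap -> kap <= 2 - 2 * cos t ->
  fk Q t <= 4 / (Q%:R * kap).
Proof.
move=> Q0 k0 kt; have Q0' : 0 < Q%:R :> R by rewrite ltr0n.
set S := \sum_(0 <= j < Q) cis (j%:R * t).
have e : (cis t - 1) * S = cis (Q%:R * t) - 1.
  rewrite cisMn subrX1 /S big_mkord; congr (_ * _).
  by apply: eq_bigr => j _; rewrite cisMn.
have le2 : cmod ((cis t - 1) * S) <= 2.
  by rewrite e (le_trans (cmodB _ _))// cmod_cis cmod1.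
have le4 : (2 - 2 * cos t) * cmod S ^+ 2 <= 4.
  rewrite -cmod_cisB1 -exprMn -cmodM.
  by have := cmod_ge0 ((cis t - 1) * S); nra.
rewrite invfM mulrCA ler_pM2l ?invr_gt0// ler_pdivlMr//.
apply: le_trans le4; rewrite mulrC ler_wpM2r// sqr_ge0//.
Qed.

(** Every [j * t] has absolute value at most 1, so each cosine in the real part is at least 1/2. *)
Lemma fejer_kernel_near Q t : (0 < Q)%N -> `|t| <= Q%:R^-1 -> Q%:R / 4 <= fk Q t.
Proof.
move=> Q0 tQ; have Q0' : 0 < Q%:R :> R by rewrite ltr0n.
set S := \sum_(0 <= j < Q) cis (j%:R * t).
have reS : Q%:R / 2 <= complex.Re S.
  have -> : complex.Re S = \sum_(0 <= j < Q) cos (j%:R * t).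
    rewrite /S; elim: (Q) => [|n ih]; first by rewrite !big_geq.
    by rewrite !big_nat_recr//= -ih; case: (\sum_(0 <= i < n) _) => a b.
  have -> : Q%:R / 2 = \sum_(0 <= j < Q) (1 / 2) :> R.
    by rewrite sumr_const_nat subn0 -[RHS]mulr_natr; ring.
  rewrite big_nat [leRHS]big_nat; apply: ler_sum => j /andP[_ jQ].
  have jt : `|j%:R * t| <= 1.
    rewrite normrM normr_nat; apply: le_trans (_ : Q%:R * Q%:R^-1 <= _).
      by rewrite ler_pM ?ler_nat// ltnW.
    by rewrite mulfV// gt_eqF.
  have : (j%:R * t) ^+ 2 <= 1.
    by rewrite -(real_normK (num_real _)) expr_le1.
  by have := cos_ge (j%:R * t); lra.
have cS : Q%:R / 2 <= cmod S.
  exact: le_trans reS (le_trans (ler_norm _) (cmod_Re _)).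
rewrite ler_pdivlMl//; have : (Q%:R / 2) ^+ 2 <= cmod S ^+ 2.
  by rewrite ler_pXn2r ?nnegrE ?divr_ge0 ?cmod_ge0.
lra.
Qed.

Lemma cos_far x d : 0 < d <= pi -> d <= `|x| <= 2 * pi - d -> cos x <= cos d.
Proof.
move=> /andP[d0 dpi] /andP[dx xd].
have dec y : d <= y <= pi -> cos y <= cos d.
  move=> /andP[dy ypi]; have [->//|ne] := eqVneq d y.
  apply: ltW; rewrite ltr_cos ?lt_neqAle ?ne// in_itv/=; apply/andP; split; lra.
rewrite -cos_norm; have [xp|xp] := leP `|x| pi; first by apply: dec; rewrite dx.
have -> : cos `|x| = cos (2 * pi - `|x|).
  by rewrite cosB mulr_natl cos2pi sin2pi mul1r mul0r addr0.
by apply: dec; apply/andP; split; lra.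
Qed.

(** The kernel minus 1 is a trigonometric polynomial with no constant term, so only nonzero
    frequencies occur. *)
Lemma mean_null_fejer_kernel (f : nat -> R[i]) (x : nat -> R) b t Q : b != 0 ->
  (forall b', b' != 0 -> mean_null (fun n => f n * cis (b' * x n))) -> (0 < Q)%N ->
  mean_null (fun n => f n * ((fk Q (b * x n - t) - 1)%:C)%C).
Proof.
move=> b0 hf Q0.
pose F j k n := cis (- ((j%:R - k%:R) * t)) * (f n * cis ((j%:R - k%:R) * b * x n)).
have h : mean_null (fun n => ((Q%:R^-1)%:C)%C *
    \sum_(j <- index_iota 0 Q) \sum_(k <- index_iota 0 Q | k != j) F j k n).
  apply/mean_nullZ/mean_null_sum => j _; apply: mean_null_sum => k kj.
  by apply/mean_nullZ/hf; rewrite mulf_neq0// subr_eq0 eqr_nat eq_sym.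
apply: eq_mean_null h => n.
rewrite rmorphB/= fejer_kernelE// rmorph1 addrC addKr mulrCA; congr (_ * _).
rewrite mulr_sumr; apply: eq_bigr => j _; rewrite mulr_sumr; apply: eq_bigr => k _.
rewrite /F mulrCA -cisD; congr (_ * cis _); ring.
Qed.

End FejerKernel.

(** * Approximation of periodic step functions *)

Section StepApproximation.
Variable R : realType.
Variables (m L M : nat) (w : nat -> R[i]) (B : R).
Hypotheses (m0 : (0 < m)%N) (L0 : (0 < L)%N) (M0 : (0 < M)%N).
Hypothesis wB : forall k, cmod (w k) <= B.

Let Q := (m * L)%N.
(** The angle [1 / (M * m)] is the image under [2 * pi / m] of the distance [1 / (2 * pi * M)] to
    the nearest integer. *)
Let kap : R := 2 - 2 * cos (M%:R * m%:R)^-1.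

(** Discrete convolution with the kernel: the grid point [q / L] lies in the step [q %/ L], and each
    unit step carries [L] grid points. *)
Definition fejer_sum (x : R) : R[i] := ((Q%:R^-1)%:C)%C * \sum_(0 <= q < Q)
  w (q %/ L)%N * ((fejer_kernel Q (2 * pi / m%:R * x - q%:R * (2 * pi / Q%:R)))%:C)%C.

Lemma sub_cos_inv_gt0 : 0 < kap.
Proof.
have mM : 1 <= M%:R * m%:R :> R by rewrite -natrM ler1n muln_gt0 M0.
have i1 : (M%:R * m%:R)^-1 <= 1 :> R by rewrite invf_le1// (lt_le_trans ltr01).
have i0 : 0 < (M%:R * m%:R)^-1 :> R by rewrite invr_gt0 (lt_le_trans ltr01).
have : cos (M%:R * m%:R)^-1 < cos (0 : R).
  by rewrite ltr_cos// in_itv/=; have := @pi_ge2 R; move=> ?; apply/andP; split; lra.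
by rewrite cos0 /kap; lra.
Qed.

(** Away from the integers the grid points of other steps are far from [x], which gives the first
    term. Near an integer the trivial bound [2 * B] is absorbed by the second term, since the kernel
    of order [M] is at least [M / 4] there. *)
Lemma fejer_sum_approx (x : R) :
  cmod (w `|(Num.floor x %% m%:Z)%Z|%N - fejer_sum x) <=
  8 * B / (Q%:R * kap) + 8 * B / M%:R * fejer_kernel M (2 * pi * x).
Proof.
set y := Num.floor x; set k := `|(y %% m%:Z)%Z|%N.
have Q0 : (0 < Q)%N by rewrite muln_gt0 m0.
have Q0' : 0 < Q%:R :> R by rewrite ltr0n.
have m0' : 0 < m%:R :> R by rewrite ltr0n.
have L0' : 0 < L%:R :> R by rewrite ltr0n.
have M0' : 0 < M%:R :> R by rewrite ltr0n.
have B0 : 0 <= B by exact: le_trans (cmod_ge0 _) (wB 0).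
have pi0 := @pi_gt0 R; have k0 := sub_cos_inv_gt0.
pose ph q : R := 2 * pi / m%:R * x - q%:R * (2 * pi / Q%:R).
have part := fejer_kernel_partition (2 * pi / m%:R * x) Q0.
(* The kernel weights sum to [Q], so [w k] can be moved inside the average. *)
have E : w k - fejer_sum x = ((Q%:R^-1)%:C)%C *
    \sum_(0 <= q < Q) (w k - w (q %/ L)%N) * ((fejer_kernel Q (ph q))%:C)%C.
  under [X in _ = _ * X]eq_bigr do rewrite mulrBl.
  rewrite sumrB -mulr_sumr -rmorph_sum/= part mulrBr /fejer_sum; congr (_ - _).
  by rewrite mulrCA -rmorphM/= mulVf ?gt_eqF// rmorph1 mulr1.
have red (b : nat -> R) : (forall q, (q < Q)%N ->
    cmod (w k - w (q %/ L)%N) * fejer_kernel Q (ph q) <= b q) ->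
    cmod (w k - fejer_sum x) <= Q%:R^-1 * \sum_(0 <= q < Q) b q.
  move=> hb; rewrite E cmodM cmod_real gtr0_norm ?invr_gt0// ler_pM2l ?invr_gt0//.
  apply: le_trans (cmod_sum _ _ _) _; rewrite big_nat [leRHS]big_nat.
  apply: ler_sum => q /andP[_ qQ]; rewrite cmodM cmod_real ger0_norm ?hb//.
  exact: fejer_kernel_ge0.
have w2 q : cmod (w k - w q) <= 2 * B.
  by apply: le_trans (cmodB _ _) _; have := wB k; have := wB q; lra.
have [[z hz]|good] := pselect (exists z : int, `|x - z%:~R| < (2 * pi * M%:R)^-1).
  have nr : M%:R / 4 <= fejer_kernel M (2 * pi * x).
    have -> : 2 * pi * x = 2 * pi * (x - z%:~R) + z%:~R * (2 * pi) by ring.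
    rewrite fejer_kernel_period; apply: fejer_kernel_near => //.
    rewrite normrM gtr0_norm ?mulr_gt0// -ler_pdivlMl ?mulr_gt0//.
    by rewrite -invfM ltW.
  have h1 : 0 <= 8 * B / (Q%:R * kap) by rewrite divr_ge0 ?mulr_ge0// ltW.
  have h2 : 2 * B <= 8 * B / M%:R * fejer_kernel M (2 * pi * x).
    have -> : 2 * B = 8 * B / M%:R * (M%:R / 4) by field; rewrite gt_eqF.
    by rewrite ler_wpM2l// divr_ge0 ?mulr_ge0.
  apply: (@le_trans _ _ (2 * B)); last by lra.
  apply: le_trans (red (fun q => 2 * B * fejer_kernel Q (ph q)) _) _.
    by move=> q _; rewrite ler_wpM2r// fejer_kernel_ge0.
  by rewrite -mulr_sumr part mulrCA mulVf ?gt_eqF// mulr1.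
have {}good (z : int) : (2 * pi * M%:R)^-1 <= `|x - z%:~R|.
  by rewrite leNgt; apply/negP => h; apply: good; exists z.
set d : R := (2 * pi * M%:R)^-1 in good.
have far q : (q < Q)%N -> cmod (w k - w (q %/ L)%N) * fejer_kernel Q (ph q) <=
    2 * B * (4 / (Q%:R * kap)).
  move=> qQ; have [->|qk] := eqVneq (q %/ L)%N k.
    by rewrite subrr cmod0 mul0r mulr_ge0 ?mulr_ge0 ?invr_ge0 ?mulr_ge0// ltW.
  apply: ler_pM; rewrite ?cmod_ge0 ?fejer_kernel_ge0//.
  (* [r] is [x] reduced modulo [m]; it lies in the step from [k] to [k + 1], at distance at least
     [d] from both ends. *)
  pose a := (y %/ m%:Z)%Z; pose r : R := x - a%:~R * m%:R.
  have yE : y%:~R = a%:~R * m%:R + k%:R :> R.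
    have kE : k%:Z = (y %% m%:Z)%Z.
      by rewrite /k gez0_abs// modz_ge0//; lia.
    rewrite -[k%:R]/(k%:Z%:~R) -[m%:R]/(m%:Z%:~R) kE -rmorphM -rmorphD/=.
    by rewrite -divz_eq.
  have km : (k < m)%N.
    have : (y %% m%:Z)%Z < `|m%:Z| by rewrite ltz_mod//; lia.
    have : 0 <= (y %% m%:Z)%Z by rewrite modz_ge0//; lia.
    rewrite /k; lia.
  have km' : k%:R + 1 <= m%:R :> R by rewrite natr1 ler_nat.
  have rl : k%:R + d <= r.
    have := good y; rewrite ger0_norm; last by rewrite subr_ge0 floor_le.
    by rewrite /r yE; lra.
  have ru : r <= k%:R + 1 - d.
    have := good (y + 1); rewrite ler0_norm; last first.
      by rewrite subr_le0 ltW// floorD1_gt.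
    by rewrite rmorphD/= yE /r; lra.
  have d0 : 0 < d by rewrite invr_gt0 !mulr_gt0.
  pose u : R := r - q%:R / L%:R.
  have phE : ph q = 2 * pi / m%:R * u + a%:~R * (2 * pi).
    by rewrite /ph /u /r /Q natrM; field; rewrite !gt_eqF.
  have ql : q%:R / L%:R < m%:R :> R by rewrite ltr_pdivrMr// -natrM ltr_nat.
  have q0 : 0 <= q%:R / L%:R :> R by rewrite divr_ge0.
  (* The grid point [q / L] lies outside the step of [r]; the upper bound is the same separation
     measured around the circle of length [m]. *)
  have ud : d <= `|u| <= m%:R - d.
    have := ler0n R k => k0'.
    have [ur|ur] : q%:R / L%:R <= k%:R :> R \/ k%:R + 1 <= q%:R / L%:R :> R.
      have := qk; rewrite neq_ltn => /orP[h|h]; [left|right].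
        by rewrite ler_pdivrMr// -natrM ler_nat ltnW// -ltn_divLR.
      by rewrite natr1 ler_pdivlMr// -natrM ler_nat -leq_divRL.
    by rewrite ger0_norm /u; [apply/andP; split; lra|lra].
    by rewrite ler0_norm /u; [apply/andP; split; lra|lra].
  rewrite phE fejer_kernel_period; apply: fejer_kernel_far => //.
  have tau : (M%:R * m%:R)^-1 = 2 * pi / m%:R * d.
    by rewrite /d; move: pi0; move: (@pi R) => p p0; field; rewrite !gt_eqF.
  have c0 : 0 < 2 * pi / m%:R :> R by rewrite divr_gt0// mulr_gt0.
  have : cos (2 * pi / m%:R * u) <= cos (M%:R * m%:R)^-1.
    apply: cos_far.
      have mM : 1 <= M%:R * m%:R :> R by rewrite -natrM ler1n muln_gt0 M0.
      have i1 : (M%:R * m%:R)^-1 <= 1 :> R by rewrite invf_le1// (lt_le_trans ltr01).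
      have i0 : 0 < (M%:R * m%:R)^-1 :> R by rewrite invr_gt0 (lt_le_trans ltr01).
      by have := @pi_ge2 R => ?; apply/andP; split; lra.
    case/andP: ud => ud1 ud2; rewrite normrM gtr0_norm// tau ler_pM2l// ud1/=.
    have -> : 2 * pi - 2 * pi / m%:R * d = 2 * pi / m%:R * (m%:R - d).
      by field; rewrite gt_eqF.
    by rewrite ler_pM2l.
  by rewrite /kap; lra.
apply: le_trans (red (fun=> 2 * B * (4 / (Q%:R * kap))) far) _.
rewrite sumr_const_nat subn0 -[X in _ * X]mulr_natl mulKf ?gt_eqF//.
have -> : 2 * B * (4 / (Q%:R * kap)) = 8 * B / (Q%:R * kap) by ring.
by rewrite lerDl mulr_ge0 ?fejer_kernel_ge0// divr_ge0// ?mulr_ge0// ltW.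
Qed.

End StepApproximation.

(** * Multiplicative functions weighted by residues of integer parts of powers *)

Section MainTheorem.
Variable R : realType.

Lemma mean_null_mult_cis_powR (c b : R) (f : nat -> R[i]) :
  0 < c -> ~ (exists k : int, c = k%:~R) -> b != 0 ->
  (forall p n, prime p -> ~~ (p %| n)%N -> f (p * n)%N = f p * f n) ->
  (forall n, cmod (f n) <= 1) ->
  mean_null (fun n => f n * cis (b * n%:R `^ c)).
Proof.
move=> c0 cnint b0 fM f1; apply: katai_orthogonality => // [n|p q pp qp pq].
  by rewrite cmod_cis.
have pc : p%:R `^ c - q%:R `^ c != 0 :> R.
  rewrite subr_eq0; apply: contra pq => /eqP.
  move/(powR_injective c0); rewrite !nnegrE !ler0n => /(_ isT isT)/eqP.
  by rewrite eqr_nat.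
apply: eq_mean_null (mean_null_cis_powR c0 cnint (mulf_neq0 b0 pc)) => n.
by rewrite -cisB !natrM !powRM//; congr cis; ring.
Qed.

(** Replace [w] by its trigonometric approximation: frequency zero is handled by [fnull], the others
    by Katai's criterion. The error [D] is small in mean because the kernel of order [M] has mean
    value 1 along [n ^ c]. *)
Lemma mean_null_mult_floor_powR (c : R) (m : nat) (w : nat -> R[i]) (B : R)
    (f : nat -> R[i]) :
  0 < c -> ~ (exists k : int, c = k%:~R) -> (0 < m)%N ->
  (forall k, cmod (w k) <= B) ->
  (forall p n, prime p -> ~~ (p %| n)%N -> f (p * n)%N = f p * f n) ->
  (forall n, cmod (f n) <= 1) -> mean_null f ->
  mean_null (fun n => f n * w (floor_pow_mod c m n)).
Proof.
move=> c0 cnint m0 wB fM f1 fnull e e0.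
have B0 : 0 <= B by exact: le_trans (cmod_ge0 _) (wB 0%N).
have e40 : 0 < e / 4 by lra.
have pi0 := @pi_gt0 R.
(* The order of choices matters: [M] from [e], then [kap] from [M], then [L] from [kap]. Successors
   keep [M] and [L] positive. *)
have [M1 hM] := archimedean_nat_mul (16 * B) e40; pose M := M1.+1.
have {hM}hM : 16 * B <= e / 4 * M%:R by apply: hM.
pose kap : R := 2 - 2 * cos (M%:R * m%:R)^-1.
have kap0 : 0 < kap by exact: sub_cos_inv_gt0.
have [L1 hL] := archimedean_nat_mul (8 * B) (mulr_gt0 e40 kap0); pose L := L1.+1.
have {hL}hL : 8 * B <= e / 4 * kap * L%:R by apply: hL.
pose Q := (m * L)%N; have Q0 : (0 < Q)%N by rewrite muln_gt0 m0.
pose x (n : nat) : R := n%:R `^ c.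
have T0 : mean_null (fun n => f n * fejer_sum m L w (x n)).
  have h q : mean_null (fun n => f n * ((fejer_kernel Q (2 * pi / m%:R * x n - q%:R * (2 * pi / Q%:R)))%:C)%C).
    have b0 : 2 * pi / m%:R != 0 :> R.
      by rewrite !mulf_neq0 ?invr_neq0 ?gt_eqF// ltr0n.
    have hf b : b != 0 -> mean_null (fun n => f n * cis (b * x n)).
      by move=> b0'; exact: mean_null_mult_cis_powR.
    apply: eq_mean_null (mean_nullD fnull (mean_null_fejer_kernel
      (q%:R * (2 * pi / Q%:R)) b0 hf Q0)) => n.
    by rewrite rmorphB/= rmorph1; ring.
  pose F n := ((Q%:R^-1 : R)%:C)%C * \sum_(q <- index_iota 0 Q) w (q %/ L)%N *
    (f n * ((fejer_kernel Q (2 * pi / m%:R * x n - q%:R * (2 * pi / Q%:R)))%:C)%C).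
  have hF : mean_null F.
    by apply/mean_nullZ/mean_null_sum => q _; exact/mean_nullZ/h.
  apply: eq_mean_null hF => n; rewrite /F /fejer_sum [RHS]mulrCA [in RHS]mulr_sumr; congr (_ * _).
  by apply: eq_bigr => q _; ring.
have [N1 h1] := T0 _ e40.
(* Here the weight is the constant 1, so the phases alone give the mean value of the kernel. *)
have K0 : mean_null (fun n => ((fejer_kernel M (2 * pi * x n) - 1)%:C)%C).
  have b0 : 2 * pi != 0 :> R by rewrite mulf_neq0// gt_eqF.
  have hf b : b != 0 -> mean_null (fun n => 1 * cis (b * x n)).
    move=> b0'; apply: eq_mean_null (mean_null_cis_powR c0 cnint b0') => n.
    by rewrite mul1r.
  apply: eq_mean_null (mean_null_fejer_kernel 0 b0 hf (ltn0Sn M1)) => n.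
  by rewrite mul1r subr0.
have [N2 h2] := K0 1 ltr01.
exists (maxn N1 N2) => N; rewrite geq_max => /andP[/h1{}h1 /h2{}h2].
have M0 : 0 < M%:R :> R by rewrite ltr0n.
have N0 : 0 <= N%:R :> R by [].
have m1 : 1 <= m%:R :> R by rewrite ler1n.
have L0 : 0 < L%:R :> R by rewrite ltr0n.
have ks : \sum_(0 <= n < N) fejer_kernel M (2 * pi * x n) <= 2 * N%:R.
  have := le_trans (ler_norm _) (le_trans (cmod_Re _) h2).
  rewrite -rmorph_sum/= sumrB sumr_const_nat subn0; lra.
pose D n := w (floor_pow_mod c m n) - fejer_sum m L w (x n).
have -> : \sum_(0 <= n < N) f n * w (floor_pow_mod c m n) =
  \sum_(0 <= n < N) f n * fejer_sum m L w (x n) + \sum_(0 <= n < N) f n * D n.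
  by rewrite -big_split/=; apply: eq_bigr => n _; rewrite /D; ring.
apply: le_trans (cmodD _ _) _.
have hD : cmod (\sum_(0 <= n < N) f n * D n) <=
    \sum_(0 <= n < N) (8 * B / (Q%:R * kap) + 8 * B / M%:R * fejer_kernel M (2 * pi * x n)).
  apply: le_trans (cmod_sum _ _ _) _; apply: ler_sum => n _.
  rewrite cmodM; apply: le_trans (fejer_sum_approx m0 (ltn0Sn L1) (ltn0Sn M1) wB (x n)).
  by rewrite ler_piMl ?cmod_ge0.
move: hD; rewrite big_split/= sumr_const_nat subn0 -[X in _ <= X + _]mulr_natr -mulr_sumr => hD.
have QR : Q%:R = m%:R * L%:R :> R by rewrite natrM.
have q1 : 8 * B / (Q%:R * kap) <= e / 4.
  rewrite ler_pdivrMr; last by rewrite mulr_gt0// ltr0n.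
  apply: le_trans hL _; rewrite QR -mulrA ler_pM2l// mulrC ler_pM2r//.
  by rewrite ler_pMl.
have q2 : 8 * B / M%:R <= e / 8 by rewrite ler_pdivrMr//; lra.
have q3 : 8 * B / M%:R * \sum_(0 <= n < N) fejer_kernel M (2 * pi * x n) <= e / 8 * (2 * N%:R).
  apply: ler_pM => //; first by rewrite divr_ge0// mulr_ge0.
  by apply: sumr_ge0 => n _; exact: fejer_kernel_ge0.
have q4 : 8 * B / (Q%:R * kap) * N%:R <= e / 4 * N%:R by rewrite ler_wpM2r.
have e4N : 0 <= e / 4 * N%:R by rewrite mulr_ge0// ltW.
move: h1 hD q3 q4 e4N; clear; lra.
Qed.

Lemma sum_from1E (F : nat -> R[i]) N :
  \sum_(1 <= n < N) F n = \sum_(0 <= n < N) (if n == 0%N then 0 else F n).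
Proof.
case: N => [|N]; first by rewrite !big_geq.
rewrite [RHS]big_ltn// add0r; by apply: eq_big_nat => -[].
Qed.

(** Sums from 1 become sums from 0 when the term at 0 is set to 0. *)
Lemma little_o_mean_null (F : nat -> R[i]) :
  little_o_N (fun N => \sum_(1 <= n < N) F n) <->
  mean_null (fun n => if n == 0%N then 0 else F n).
Proof.
split=> h e /h[N0 hN]; exists N0 => N /hN; rewrite sum_from1E normrE_cmod lecR//.
Qed.

End MainTheorem.

Unset Implicit Arguments.

Theorem theorem4 (R : realType) (c : R) (m : nat) (G : 'I_m -> R[i]) :
  1 < c -> ~ (exists k : int, c = k%:~R) -> (2 <= m)%N ->
  forall f : nat -> R[i],
    mult_arith f ->
    (forall n : nat, (0 < n)%N -> `|f n| <= 1) ->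
    little_o_N (fun N => \sum_(1 <= n < N) f n) ->
    little_o_N (fun N => \sum_(1 <= n < N) f n * evalG G (floor_pow_mod c m n)).
Proof.
move=> c1 cnint m2 f [_ fM] f1 /little_o_mean_null fnull; apply/little_o_mean_null.
(* No bound on [f 0] is assumed; the value 0 there makes the bound by 1 hold for all [n]. *)
pose f0 n : R[i] := if n == 0%N then 0 else f n.
have c0 : 0 < c by exact: lt_trans ltr01 c1.
pose B : R := \sum_(i < m) cmod (G i).
have wB k : cmod (evalG G k) <= B.
  rewrite /evalG; case: insub => [i|]; last first.
    by rewrite cmod0 sumr_ge0// => i _; exact: cmod_ge0.
  by rewrite /B (bigD1 i)//= lerDl sumr_ge0// => j _; exact: cmod_ge0.
(* A prime not dividing [n] forces [n] to be nonzero and coprime to it. *)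
have f0M p n : prime p -> ~~ (p %| n)%N -> f0 (p * n)%N = f0 p * f0 n.
  move=> pp pn; have p0 := prime_gt0 pp.
  have n0 : (0 < n)%N by rewrite lt0n; apply: contra pn => /eqP ->; exact: dvdn0.
  rewrite /f0 !eqn0Ngt muln_gt0 p0 n0/=; apply: fM => //.
  by rewrite prime_coprime.
have f01 n : cmod (f0 n) <= 1.
  rewrite /f0; case: eqP => [_|/eqP n0]; first by rewrite cmod0.
  by have := f1 n; rewrite lt0n n0 normrE_cmod -(rmorph1 (real_complex R)) lecR; apply.
apply: eq_mean_null (mean_null_mult_floor_powR c0 cnint (ltnW m2) wB f0M f01 fnull) => n.
by rewrite /f0; case: ifP => _; rewrite ?mul0r.
Qed.
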